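(* For every $n\ge1$, $k\in\{1,\dots,n\}$, $r\in\mathbb{R}$, $\boldsymbol a\in\mathbb{R}^n$ and tolerance $\epsilon$, the algorithm EIPS (described in the context) for computing the Euclidean projection of $\boldsymbol a$ onto $\{\boldsymbol x\in\mathbb{R}^n:\mathrm{T}_{(k)}(\boldsymbol x)\le r\}$ terminates in a finite number of iterations. Furthermore, its worst-case complexity is $O((n+k)n^2)$.
   Context: Notation. $\vec a_1\ge\cdots\ge\vec a_n$ are the components of $\boldsymbol a$ in nonincreasing order; $\mathrm{T}_{(k)}(\boldsymbol x)$ is the sum of the $k$ largest components of $\boldsymbol x$; $\mathbf 1_n$ is the all-ones vector; $\mathcal I(\boldsymbol a,\theta,+):=\{i:a_i\ge\theta\}$, $\mathcal I(\boldsymbol a,-,\theta):=\{i:a_i<\theta\}$, $\mathcal I(\boldsymbol a,\theta_1,\theta_2):=\{i:\theta_1\le a_i<\theta_2\}$. Complexity is the number of real arithmetic operations and comparisons, in exact arithmetic; $\epsilon\ge0$. $$F_r(u)=\tfrac1k\Big(r-\sum_{i=1}^n\max\{a_i-u,0\}\Big),\qquad F_r'(u^-)=|\mathcal I(\boldsymbol a,u,+)|/k \ \text{(left derivative)},$$ the last formula being used also for $u=\pm\infty$ (values $0$ at $+\infty$ and $n/k$ at $-\infty$). $$g_r(u,l)=\sum_{i=1}^n\max\{a_i-u,0\}-\sum_{i=1}^n\max\{a_i-l,0\}+k(u-l),$$ $G_r(u)=\min\{l:g_r(u,l)=0\}$ for $u>\vec a_{k+1}$ (and the same formula, giving $\vec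 a_{k+1}$, if $u=\vec a_{k+1}$ is ever evaluated), $D(u)=G_r(u)-F_r(u)$; $D'(u^+)$ is the right derivative. Evaluation of $G_r(u)$ for $u>\vec a_{k+1}$ (G-Searching). Let $m=|\mathcal I(\boldsymbol a,u,+)|$, $H=k-m\ge0$, and let $\boldsymbol b$ be the list $(a_i)_{i\in\mathcal I(\boldsymbol a,-,u)}$. If $H=0$ return $\max\{a_j:a_j<u\}$. Otherwise let $\boldsymbol v=(b_1,\dots,b_N)$ with $N>H$ (e.g. $N=H+1$), $\rho=(\sum_{b\in\boldsymbol v}b-Hu)/(|\boldsymbol v|-H)$. For $j=N+1,\dots,|\boldsymbol b|$: if $b_j>\rho$, append $b_j$ to $\boldsymbol v$ and set $\rho\leftarrow\rho+(b_j-\rho)/(|\boldsymbol v|-H)$ (with the new $|\boldsymbol v|$). Then, repeatedly until $|\boldsymbol v|$ does not change in a pass: for each $b\in\boldsymbol v$, if $b\le\rho$, remove $b$ from $\boldsymbol v$ and set $\rho\leftarrow\rho+(\rho-b)/(|\boldsymbol v|-H)$ (with the new $|\boldsymbol v|$). Return $\rho$. EIPS. If $k=1$ return the vector with entries $\min\{r,a_i\}$. If $k=n$ return $\boldsymbol a+(r-\max\{r,\mathbf 1_n^\top\boldsymbol a\})\mathbf 1_n/n$. Otherwise ($2\le k\le n-1$): Initialization step. Set $i=1$, $u^1=r/k$, $u_R=+\infty$, $u_L=-\infty$. Repeat: - if $F_r(u^i)=u^i$, stop and return $\boldsymbol x^\star=\boldsymbol a$; - if $F_r'((u^i)^-)=1$,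 let $\vec a_k=\min\{a_j:a_j\ge u^i\}$; if $g_r(\vec a_k,F_r(\vec a_k))=0$, set $u^\star=\vec a_k$, $l^\star=F_r(\vec a_k)$ and go to the final construction; - if $F_r'((u^i)^-)\ge1$, leave this loop; - otherwise set $u^{i+1}=\dfrac{u^i|\mathcal I(\boldsymbol a,u^i,+)|-kF_r(u^i)}{|\mathcal I(\boldsymbol a,u^i,+)|-k}$ and $i\leftarrow i+1$. After the loop: - if $i=1$ and $g_r(\vec a_1,F_r(\vec a_1))<0$: set $u^\star=+\infty$, $l^\star=r/k$, and go to the final construction; - if $i=1$ and otherwise (Flag 1): $u_R=\vec a_1$, $u_C=u_R+D(u_R)\,|\mathcal I(\boldsymbol a,G_r(u_R),u_R)|/k$; - if $i>1$ and $g_r(u^{i-1},F_r(u^{i-1}))<0$ (Flag 2): $u_L=u^{i-1}$, $u_C=(u_L+u')/2$ with $u'=u^{i-1}+kD(u^{i-1})/|\mathcal I(\boldsymbol a,u^{i-1},+)|$; - if $i>1$ and otherwise (Flag 3): $u_R=u^{i-1}$, $u_C=(u_R+\max\{u'',u^i\})/2$ with $u''=u^{i-1}+kD(u^{i-1})/|\mathcal I(\boldsymbol a,u^{i-1},+)|$. Pivot step. Repeat (P1)–(P5) until a ''break'': (P1) while $F_r'((u_C)^-)>1$, set $u_C\leftarrow(u_C+u_R)/2$. (P2) If $|D(u_C)|\le\epsilon$: $u_L\leftarrow u_C$ and break. (P3) If $F_r'((u_C)^-)=F_r'((u_L)^-)$: [if $D(u_C)>0$, set $u_L\leftarrow u_C$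 and then $u_C\leftarrow\min\{a_i:a_i>u_C\}$; then, if $D(u_C)\le0$ for the current $u_C$, break]. Else if $F_r'((u_C)^-)=F_r'((u_R)^-)$: [if $D(u_C)<0$, set $u_R\leftarrow u_C$ and then $u_C\leftarrow\max\{a_i:a_i<u_C\}$; then, if $D(u_C)\ge0$ for the current $u_C$, set $u_L\leftarrow u_C$ and break]. (P4) If $u_R=+\infty$: if $D(u_C)<0$ then $u_R\leftarrow u_C$, else $u_{LB}\leftarrow u_L$ and $u_L\leftarrow u_C$. Else if $u_L=-\infty$: if $D(u_C)>0$ then $u_L\leftarrow u_C$, else $u_{RB}\leftarrow u_R$ and $u_R\leftarrow u_C$. Else: $u_R\leftarrow u_C$ if $D(u_C)<0$; $u_L\leftarrow u_C$ if $D(u_C)>0$. (P5) With $\mathrm{Generate}(x,y)=\dfrac{-xD(y)+yD(x)}{-D(y)+D(x)}$, set $u_C=\mathrm{Generate}(u_{LB},u_L)$ if $u_R=+\infty$; $u_C=\mathrm{Generate}(u_{RB},u_R)$ if $u_L=-\infty$; $u_C=\mathrm{Generate}(u_R,u_L)$ otherwise. Exact step. While $|D(u_L)|>\epsilon$, set $u_L\leftarrow u_L-D(u_L)/D'((u_L)^+)$. Then let $m=|\mathcal I(\boldsymbol a,u_L,+)|$; if $m=k$ set $u^\star=\min\{a_i:a_i\ge u_L\}$, else set $u^\star=u_L$; in both cases $l^\star=F_r(u^\star)$. Final construction. Return $\boldsymbol x^\star$ with $x^\star_i=a_i-(u^\star-l^\star)$ if $a_i>u^\star$, $x_i^\star=l^\star$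 if $l^\star\le a_i\le u^\star$, $x_i^\star=a_i$ if $a_i<l^\star$. *)

(* Defs.v *)
From mathcomp Require Import all_boot all_order all_algebra.
From mathcomp Require Import reals constructive_ereal.

Set Implicit Arguments.
Unset Strict Implicit.
Unset Printing Implicit Defensive.

Import Order.TTheory GRing.Theory Num.Theory.
Local Open Scope ring_scope.

(* Cost-counting partial computations. The argument [fuel] bounds the number  *)
(* of iterations of each single execution of a loop. The outcome is           *)
(* [Some (c, x)] when every loop stops within the bound, x being the result   *)
(* and c the number of elementary operations; it is [None] when a loop        *)
(* exhausts the bound or an undefined operation is met (division by zero,     *)
(* extremum of the empty set, arithmetic on an infinite value). A result      *)
(* obtained for some fuel is the same for every larger fuel, so terminating   *)
(* means that [Some _] is reached for some fuel.                              *)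
Definition comp (A : Type) := nat -> option (nat * A).

Definition ret A (x : A) : comp A := fun _ => Some (0%N, x).
Definition fail A : comp A := fun _ => None.
Definition bind A B (p : comp A) (f : A -> comp B) : comp B := fun fuel =>
  if p fuel is Some (c1, x) then
    if f x fuel is Some (c2, y) then Some ((c1 + c2)%N, y) else None
  else None.

(* [charge c x] is always applied to an expression x that performs at most c  *)
(* arithmetic operations and comparisons. Counters (cardinalities, list       *)
(* lengths) are natural numbers whose updates and comparisons are charged as  *)
(* well; only copying, list storage and embedding a counter into R are free.  *)
Definition charge A (c : nat) (x : A) : comp A := fun _ => Some (c, x).

Notation "'let!' x ':=' p 'in' q" := (bind p (fun x => q))
  (at level 200, x name, p at level 100, q at level 200,
   format "'let!'  x  ':='  p  'in' '//' q").

(* The body returns [inl s] to iterate again from s, [inr b] to exit with b.  *)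
Fixpoint loop_upto S B (body : S -> comp (S + B)) (t : nat) (s : S) : comp B :=
  if t is t'.+1 then
    let! o := body s in
    match o with
    | inl s' => loop_upto body t' s'
    | inr b => ret b
    end
  else fail B.
Definition loop S B (body : S -> comp (S + B)) (s : S) : comp B :=
  fun fuel => loop_upto body fuel s fuel.

Fixpoint foldC S T (f : S -> T -> comp S) (s : S) (l : seq T) : comp S :=
  if l is x :: l' then let! s' := f s x in foldC f s' l' else ret s.

Fixpoint mapC T U (f : T -> comp U) (l : seq T) : comp (seq U) :=
  if l is x :: l' then
    let! y := f x in
    let! ys := mapC f l' in
    ret (y :: ys)
  else ret [::].

Section Algorithm.

Variable R : realFieldType.

Definition divide (x y : R) : comp R :=
  if y == 0 then fail R else charge 1 (x / y).

Definition finite (x : \bar R) : comp R :=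
  if x is y%:E then ret y else fail R.

Variables (a : seq R) (k : nat) (r eps : R).

(* Size N > H of the initial list in G-Searching, a free choice that may      *)
(* depend on H and on the list b.                                             *)
Variable initN : nat -> seq R -> nat.

Definition sum_pos (u : R) : comp R :=
  foldC (fun s x => charge 3 (s + Num.max (x - u) 0)) 0 a.

Definition evalF (u : R) : comp R :=
  let! s := sum_pos u in
  let! t := charge 1 (r - s) in
  divide t k%:R.

Definition evalg (u l : R) : comp R :=
  let! su := sum_pos u in
  let! sl := sum_pos l in
  charge 4 (su - sl + k%:R * (u - l)).

Definition count_ge (u : R) : comp nat :=
  foldC (fun m x => charge 2 (m + (u <= x)%R)%N) 0%N a.

Definition count_gt (u : R) : comp nat :=
  foldC (fun m x => charge 2 (m + (u < x)%R)%N) 0%N a.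

Definition count_between (u1 u2 : R) : comp nat :=
  foldC (fun m x => charge 3 (m + ((u1 <= x) && (x < u2))%R)%N) 0%N a.

Definition left_dF (u : \bar R) : comp R :=
  match u with
  | x%:E => let! m := count_ge x in divide m%:R k%:R
  | +oo%E => ret 0
  | -oo%E => divide (size a)%:R k%:R
  end.

Definition extremum (le : rel R) (P : pred R) : comp R :=
  let better x best := if best is Some y then le x y else true in
  let! best := foldC (fun best x =>
    charge 2 (if P x && better x best then Some x else best)) None a in
  if best is Some y then ret y else fail R.

Definition min_of (P : pred R) : comp R := extremum (fun x y => x <= y) P.
Definition max_of (P : pred R) : comp R := extremum (fun x y => y <= x) P.

Definition append_scan (H : nat) (st : seq R * R) (b : R) : comp (seq R * R) :=
  let: (v, rho) := st in
  let! test := charge 1 (rho < b) in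
  if test then
    let! num := charge 1 (b - rho) in
    let! den := charge 2 ((size v).+1%:R - H%:R) in
    let! q := divide num den in
    let! rho' := charge 1 (rho + q) in
    ret (rcons v b, rho')
  else ret (v, rho).

(* State of a removal pass: elements kept so far, current |v|, current rho.   *)
Definition remove_scan (H : nat) (st : seq R * nat * R) (b : R) :
    comp (seq R * nat * R) :=
  let: (kept, sz, rho) := st in
  let! test := charge 1 (b <= rho) in
  if test then
    let! num := charge 1 (rho - b) in
    let! sz' := charge 1 sz.-1 in
    let! den := charge 1 (sz'%:R - H%:R) in
    let! q := divide num den in
    let! rho' := charge 1 (rho + q) in
    ret (kept, sz', rho')
  else ret (rcons kept b, sz, rho).

Definition remove_pass (H : nat) (st : seq R * R) :
    comp ((seq R * R) + R) :=
  let: (v, rho) := st in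
  let! out := foldC (remove_scan H) ([::], size v, rho) v in
  let: (v', sz, rho') := out in
  let! unchanged := charge 1 (sz == size v) in
  ret (if unchanged then inr rho' else inl (v', rho')).

(* The case k < m is u <= \vec a_{k+1}: there l |-> g_r(u, l) is strictly     *)
(* increasing up to its zero l = u, so that min {l : g_r(u, l) = 0} = u.      *)
Definition evalG (u : R) : comp R :=
  let! m := count_ge u in
  let! degenerate := charge 1 (k < m)%N in
  if degenerate then ret u else
  let! H := charge 1 (k - m)%N in
  let! H0 := charge 1 (H == 0)%N in
  if H0 then max_of (fun x => x < u) else
  let! b := foldC (fun b x => charge 1 (if x < u then rcons b x else b)) [::] a in
  let N := initN H b in
  let v := take N b in
  let! s := foldC (fun s x => charge 1 (s + x)) 0 v in
  let! num := charge 2 (s - H%:R * u) in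
  let! den := charge 1 ((size v)%:R - H%:R) in
  let! rho := divide num den in
  let! st := foldC (append_scan H) (v, rho) (drop N b) in
  loop (remove_pass H) st.

Definition evalD (u : R) : comp R :=
  let! G := evalG u in
  let! F := evalF u in
  charge 1 (G - F).

(* D'(u^+) for u >= \vec a_{k+1}. With l = G_r(u), the identity g_r(u, l) = 0 *)
(* reads phi(u) = phi(l) for phi(x) = \sum_i max(a_i - x, 0) + k x. The right *)
(* derivative of phi at u is k - m, m = #{i : a_i > u}, and its left        *)
(* derivative at l is k - q, q = #{i : a_i >= l} > k. Since G_r is            *)
(* nonincreasing, G_r'(u^+) = - (k - m) / (q - k), while F_r'(u^+) = m / k.   *)
Definition evalD' (u : R) : comp R :=
  let! m := count_gt u in
  let! l := evalG u in
  let! q := count_ge l in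
  let! num := charge 1 (k%:R - m%:R) in
  let! den := charge 1 (q%:R - k%:R) in
  let! s := divide num den in
  let! t := divide m%:R k%:R in
  charge 2 (- s - t).

Definition final (u : \bar R) (l : R) : comp (seq R) :=
  mapC (fun x => charge 4
    (if (u < x%:E)%E then x - (fine u - l) else if l <= x then l else x)) a.

(* The three ways of leaving the initialization loop: returning a itself,     *)
(* having found u^\star and l^\star, or with the current u^i and u^{i-1}.     *)
(* In [Leave u prev], [prev = None] encodes i = 1.                            *)
Inductive init_outcome :=
| Feasible
| Solved of R & R
| Leave of R & option R.

Definition init_body (st : R * option R) :
    comp ((R * option R) + init_outcome) :=
  let: (u, prev) := st in
  let! f := evalF u in
  let! fixed := charge 1 (f == u) in
  if fixed then ret (inr Feasible) else
  let! d := left_dF u%:E in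
  let! d_eq1 := charge 1 (d == 1) in
  let! solved :=
    (if d_eq1 then
       let! ak := min_of (fun x => u <= x) in
       let! fak := evalF ak in
       let! gak := evalg ak fak in
       let! z := charge 1 (gak == 0) in
       ret (if z then Some (ak, fak) else None)
     else ret None) in
  if solved is Some (ak, fak) then ret (inr (Solved ak fak)) else
  let! d_ge1 := charge 1 (1 <= d) in
  if d_ge1 then ret (inr (Leave u prev)) else
  let! m := count_ge u in
  let! num := charge 3 (u * m%:R - k%:R * f) in
  let! den := charge 1 (m%:R - k%:R) in
  let! u' := divide num den in
  ret (inl (u', Some u)).

(* uLB and uRB are unassigned at first; the infinite values given to them and *)
(* to uL, uR are never legal operands of an arithmetic operation.             *)
Record pivot_state := Pivot {
  uC : R; uL : \bar R; uR : \bar R; uLB : \bar R; uRB : \bar R }.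

Definition start_flag1 (a1 : R) : comp pivot_state :=
  let! d := evalD a1 in
  let! l := evalG a1 in
  let! m := count_between l a1 in
  let! t := charge 1 (d * m%:R) in
  let! q := divide t k%:R in
  let! c := charge 1 (a1 + q) in
  ret (Pivot c -oo%E a1%:E -oo%E +oo%E).

Definition start_flag23 (u prev : R) : comp pivot_state :=
  let! f := evalF prev in
  let! g := evalg prev f in
  let! neg := charge 1 (g < 0) in
  let! d := evalD prev in
  let! m := count_ge prev in
  let! num := charge 1 (k%:R * d) in
  let! q := divide num m%:R in
  let! u' := charge 1 (prev + q) in
  if neg then
    let! c := charge 2 ((prev + u') / 2) in
    ret (Pivot c prev%:E +oo%E -oo%E +oo%E)
  else
    let! c := charge 3 ((prev + Num.max u' u) / 2) in
    ret (Pivot c -oo%E prev%:E -oo%E +oo%E).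

Definition P1_body (hi : \bar R) (c : R) : comp (R + R) :=
  let! d := left_dF c%:E in
  let! big := charge 1 (1 < d) in
  if big then
    let! w := finite hi in
    let! c' := charge 2 ((c + w) / 2) in
    ret (inl c')
  else ret (inr c).

(* (P3), given d = D(u_C): [inr x] is a break with u_L = x; otherwise the     *)
(* new state is returned with the value of D at its u_C.                      *)
Definition P3 (st : pivot_state) (d : R) : comp ((pivot_state * R) + \bar R) :=
  let: Pivot c lo hi lb rb := st in
  let! dC := left_dF c%:E in
  let! dL := left_dF lo in
  let! eqL := charge 1 (dC == dL) in
  if eqL then
    let! pos := charge 1 (0 < d) in
    let! new :=
      (if pos then
         let! c' := min_of (fun x => c < x) in
         let! d' := evalD c' in
         ret (Pivot c' c%:E hi lb rb, d')
       else ret (st, d)) in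
    let! stop := charge 1 (new.2 <= 0) in
    ret (if stop then inr (uL new.1) else inl new)
  else
  let! dR := left_dF hi in
  let! eqR := charge 1 (dC == dR) in
  if eqR then
    let! neg := charge 1 (d < 0) in
    let! new :=
      (if neg then
         let! c' := max_of (fun x => x < c) in
         let! d' := evalD c' in
         ret (Pivot c' lo c%:E lb rb, d')
       else ret (st, d)) in
    let! stop := charge 1 (0 <= new.2) in
    ret (if stop then inr (uC new.1)%:E else inl new)
  else ret (inl (st, d)).

Definition P4 (st : pivot_state) (d : R) : comp pivot_state :=
  let: Pivot c lo hi lb rb := st in
  charge 2
    (if hi == +oo%E then
       if d < 0 then Pivot c lo c%:E lb rb else Pivot c c%:E hi lo rb
     else if lo == -oo%E then
       if 0 < d then Pivot c c%:E hi lb rb else Pivot c lo c%:E lb hi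
     else
       if d < 0 then Pivot c lo c%:E lb rb
       else if 0 < d then Pivot c c%:E hi lb rb
       else st).

Definition generate (ex ey : \bar R) : comp R :=
  let! x := finite ex in
  let! y := finite ey in
  let! dx := evalD x in
  let! dy := evalD y in
  let! num := charge 4 (- x * dy + y * dx) in
  let! den := charge 2 (- dy + dx) in
  divide num den.

Definition P5 (st : pivot_state) : comp pivot_state :=
  let: Pivot c lo hi lb rb := st in
  let! c' :=
    (if hi == +oo%E then generate lb lo
     else if lo == -oo%E then generate rb hi
     else generate hi lo) in
  ret (Pivot c' lo hi lb rb).

(* A pivot iteration; on a break, only u_L is needed afterwards.              *)
Definition pivot_body (st : pivot_state) : comp (pivot_state + \bar R) :=
  let! c := loop (P1_body (uR st)) (uC st) in
  let st1 := Pivot c (uL st) (uR st) (uLB st) (uRB st) in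
  let! d := evalD c in
  let! small := charge 2 (`|d| <= eps) in
  if small then ret (inr c%:E) else
  let! o := P3 st1 d in
  match o with
  | inr x => ret (inr x)
  | inl st2 =>
      let! st3 := P4 st2.1 st2.2 in
      let! st4 := P5 st3 in
      ret (inl st4)
  end.

Definition exact_body (u : R) : comp (R + R) :=
  let! d := evalD u in
  let! large := charge 2 (eps < `|d|) in
  if large then
    let! d' := evalD' u in
    let! q := divide d d' in
    let! u' := charge 1 (u - q) in
    ret (inl u')
  else ret (inr u).

Definition pivot_and_exact (st : pivot_state) : comp (seq R) :=
  let! e := loop pivot_body st in
  let! u0 := finite e in
  let! u := loop exact_body u0 in
  let! m := count_ge u in
  let! eqk := charge 1 (m == k) in
  let! ustar := (if eqk then min_of (fun x => u <= x) else ret u) in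
  let! lstar := evalF ustar in
  final ustar%:E lstar.

Definition EIPS_main : comp (seq R) :=
  let! u1 := divide r k%:R in
  let! o := loop init_body (u1, None) in
  match o with
  | Feasible => ret a
  | Solved u l => final u%:E l
  | Leave _ None =>
      let! a1 := max_of predT in
      let! f := evalF a1 in
      let! g := evalg a1 f in
      let! neg := charge 1 (g < 0) in
      if neg then
        let! l := divide r k%:R in
        final +oo%E l
      else
        let! st := start_flag1 a1 in
        pivot_and_exact st
  | Leave u (Some prev) =>
      let! st := start_flag23 u prev in
      pivot_and_exact st
  end.

Definition EIPS : comp (seq R) :=
  let n := size a in
  let! is1 := charge 1 (k == 1)%N in
  if is1 then mapC (fun x => charge 1 (Num.min r x)) a else
  let! isn := charge 1 (k == n) in
  if isn then
    let! s := foldC (fun s x => charge 1 (s + x)) 0 a in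
    let! t := charge 2 (r - Num.max r s) in
    let! q := divide t n%:R in
    mapC (fun x => charge 1 (x + q)) a
  else EIPS_main.

End Algorithm.

(* Main.v *)
Require Import Defs.
From mathcomp Require Import all_boot all_order all_algebra.
From mathcomp Require Import reals constructive_ereal.
From mathcomp Require Import zify ring lra.

(** Let P(u) be the sum of the excesses max(a_i - u, 0), so that
    F(u) = (r - P(u)) / k, and let phi(x) = P(x) + k x, so that g_r(u, l) = 0
    reads phi(u) = phi(l). All these functions are piecewise affine, with
    slopes that count the entries above a threshold, and P is convex: the
    subgradient inequalities [excess_cge] and [excess_cgt] yield nearly all that
    is needed about P. With A the entry of rank k + 1, phi decreases up to A
    and does not decrease afterwards. Hence G(u) is the only point at most A
    where phi takes the value phi(u), the function D = G - F decreases strictly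
    from A on ([D_dec]), and its zero is what the pivot and exact steps look
    for. The complexity follows from bounding the number of iterations of each
    loop.

    - One evaluation of G costs O(n^2) ([evalG_is_G]): the current rho never
      exceeds the solution, so discarded elements stay discarded, every pass
      but the last removes an element, and more than H elements always remain,
      so that no division by zero occurs.

    - The initialization is the Newton iteration for the concave function
      F - id, coming from the right ([init_newton_step]): each step lets at
      least one more entry pass above the current point. On leaving it towards
      the pivot step, F(x) < x for all x ([infeasible]), whence D(A) > 0, and
      D is at most 0 at the largest entry.

    - A pivot iteration brackets the zero of D. Either no entry separates the
      trial point from one of the ends, and then it stops or moves the trial
      point to the next entry, or entries are found on both sides. In both
      cases a count of the entries left in the bracket decreases
      ([potential]), so that 2 n + 1 iterations suffice.

    - The bisections inside a pivot iteration could depend on the data, since a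
      trial point extrapolated to the left may fall below A. But u - G(u) is at
      most (k + 1) (u - A) ([G_lower]) and D decreases at rate at least 1 / k
      up to the largest entry, which bounds the undershoot by 2 n (n + 1) times
      uR - A: at most 2 n + 2 halvings bring the trial point back above A
      ([P1_runs]).

    - Unless it stops at once, the exact step starts where no entry lies between
      uL and the zero. There D is convex, the Newton iterates increase towards
      the zero, and each step lets G(u) fall to or below one more entry
      ([newton_step]).

    All loops thus run O(n) times, each iteration of the two outer ones
    evaluates D a bounded number of times, and the total is O(n^3). *)

Set Implicit Arguments.
Unset Strict Implicit.
Unset Printing Implicit Defensive.

Import Order.TTheory GRing.Theory Num.Theory.
Local Open Scope ring_scope.

(** * Total correctness with a cost bound *)

(** The fuel is a parameter of the triple because all loops, nested ones
    included, share the same one. *)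
Definition runs A (p : Defs.comp A) (fuel c : nat) (Q : A -> Prop) : Prop :=
  exists c' x, [/\ p fuel = Some (c', x), (c' <= c)%N & Q x].

Section Runs.

Variable fuel : nat.

Lemma runs_weaken A (p : Defs.comp A) c c' (Q Q' : A -> Prop) :
  runs p fuel c Q -> (c <= c')%N -> (forall x, Q x -> Q' x) ->
  runs p fuel c' Q'.
Proof.
move=> [d [x [e le_d Qx]]] le_c QQ'; exists d, x; split=> //; last exact: QQ'.
exact: leq_trans le_d le_c.
Qed.

Lemma runs_ret A (x : A) c (Q : A -> Prop) : Q x -> runs (ret x) fuel c Q.
Proof. by move=> Qx; exists 0%N, x. Qed.

Lemma runs_charge A (x : A) c c1 (Q : A -> Prop) :
  (c1 <= c)%N -> Q x -> runs (charge c1 x) fuel c Q.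
Proof. by move=> le_c Qx; exists c1, x. Qed.

(** The cost already spent is subtracted from the budget, so that a sequence of
    steps leaves only inequalities between explicit numbers. *)
Lemma runs_bind A B (p : Defs.comp A) (f : A -> Defs.comp B) c c1 P Q :
  runs p fuel c1 P -> (c1 <= c)%N ->
  (forall x, P x -> runs (f x) fuel (c - c1) Q) ->
  runs (bind p f) fuel c Q.
Proof.
move=> [d [x [e le_d Px]]] le_c /(_ x Px) [d' [y [e' le_d' Qy]]].
by exists (d + d')%N, y; split=> //; [rewrite /bind e e' | lia].
Qed.

Lemma runs_bind_eq A B (p : Defs.comp A) (f : A -> Defs.comp B) c c1 v Q :
  runs p fuel c1 (eq v) -> (c1 <= c)%N -> runs (f v) fuel (c - c1) Q ->
  runs (bind p f) fuel c Q.
Proof. by move=> rp le_c rf; apply: (runs_bind rp) => // _ <-. Qed.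

Lemma runs_bind_charge A B (x : A) (f : A -> Defs.comp B) c c1 Q :
  (c1 <= c)%N -> runs (f x) fuel (c - c1) Q ->
  runs (bind (charge c1 x) f) fuel c Q.
Proof. by apply: runs_bind_eq; apply: runs_charge. Qed.

Lemma runs_bind_ret A B (x : A) (f : A -> Defs.comp B) c Q :
  runs (f x) fuel c Q -> runs (bind (ret x) f) fuel c Q.
Proof.
move=> rf; apply: (@runs_bind_eq _ _ _ _ _ 0 x) => //.
  exact: runs_ret.
by rewrite subn0.
Qed.

Lemma runs_bind_divide (R : realFieldType) B (x y : R)
    (f : R -> Defs.comp B) c Q :
  y != 0 -> (1 <= c)%N -> runs (f (x / y)) fuel (c - 1) Q ->
  runs (bind (divide x y) f) fuel c Q.
Proof.
move=> y0; apply: runs_bind_eq; rewrite /divide (negbTE y0).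
exact: runs_charge.
Qed.

Lemma runs_divide (R : realFieldType) (x y : R) c (Q : R -> Prop) :
  y != 0 -> (1 <= c)%N -> Q (x / y) -> runs (divide x y) fuel c Q.
Proof. by move=> y0 c0 Qx; rewrite /divide (negbTE y0); apply: runs_charge. Qed.

(** [I t s] reads: from the state [s], at most [t] further iterations do not
    exit; every iteration costs at most [c]. *)
Lemma runs_loop S B (body : S -> Defs.comp (S + B)) c (I : nat -> S -> Prop)
    (Q : B -> Prop) t0 s0 :
  (forall t s, (t <= t0)%N -> I t s ->
     runs (body s) fuel c
       (fun o => match o with
                 | inl s' => exists2 t', (t' < t)%N & I t' s'
                 | inr b => Q b
                 end)) ->
  (t0 < fuel)%N -> I t0 s0 -> runs (loop body s0) fuel (c * t0.+1) Q.
Proof.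
move=> Hbody lt_fuel I0.
suff H m t s fu : (t < m)%N -> (t < fu)%N -> (t <= t0)%N -> I t s ->
    runs (loop_upto body fu s) fuel (c * t.+1) Q by exact: (H t0.+1).
elim: m t s fu => // m IHm t s [|fu] // lt_tm lt_fu le_t0 It /=.
apply: (runs_bind (Hbody _ _ le_t0 It)); first by nia.
case=> [s' [t' lt_t' It'] | b Qb]; last exact: runs_ret.
apply: runs_weaken (IHm t' s' fu _ _ _ It') _ _ => //; nia.
Qed.

(** [Inv s l]: the state is [s] and the elements of [l] are still to come. *)
Lemma runs_foldC S T (f : S -> T -> Defs.comp S) c (Inv : S -> seq T -> Prop)
    s l :
  (forall s x l, Inv s (x :: l) -> runs (f s x) fuel c (fun s' => Inv s' l)) ->
  Inv s l -> runs (foldC f s l) fuel (c * size l) (fun s' => Inv s' [::]).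
Proof.
move=> Hf; elim: l s => [|x l IHl] s Is /=; first exact: runs_ret.
apply: (runs_bind (Hf _ _ _ Is)); first by nia.
move=> s' Is'; apply: runs_weaken (IHl _ Is') _ _ => //; nia.
Qed.

Lemma runs_foldC_charge S T c (f : S -> T -> S) s l :
  runs (foldC (fun s x => charge c (f s x)) s l) fuel (c * size l)
    (eq (foldl f s l)).
Proof.
have /= := @runs_foldC _ _ (fun s x => charge c (f s x)) c
  (fun s' l' => foldl f s l = foldl f s' l') s l.
by apply=> // s' x l' /= ->; apply: runs_charge.
Qed.

Lemma runs_mapC_charge T U c (f : T -> U) l :
  runs (mapC (fun x => charge c (f x)) l) fuel (c * size l) (eq (map f l)).
Proof.
elim: l => [|x l IHl] /=; first exact: runs_ret.
apply: runs_bind_charge; first by nia.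
apply: (runs_bind_eq IHl); first by nia.
exact: runs_ret.
Qed.

End Runs.

(** * Counts and sums of excesses *)

Section Excess.

Variable R : realFieldType.
Implicit Types (s : seq R) (x y u l : R).

Definition excess s u : R := \sum_(x <- s) Num.max (x - u) 0.
Definition num_ge s u : nat := count (fun x => u <= x) s.
Definition num_gt s u : nat := count (fun x => u < x) s.

Lemma excess_cons x s u : excess (x :: s) u = Num.max (x - u) 0 + excess s u.
Proof. by rewrite /excess big_cons. Qed.

Lemma excess_cat s1 s2 u : excess (s1 ++ s2) u = excess s1 u + excess s2 u.
Proof. by rewrite /excess big_cat. Qed.

Lemma excess_rcons s x u :
  excess (rcons s x) u = excess s u + Num.max (x - u) 0.
Proof. by rewrite -cats1 excess_cat excess_cons /excess big_nil addr0. Qed.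

Lemma excess_ge0 s u : 0 <= excess s u.
Proof. by apply: sumr_ge0 => x _; rewrite le_max lexx orbT. Qed.

(** The excess is convex in the threshold; [- num_ge] and [- num_gt] are its
    left and right derivatives, hence subgradients. *)
Lemma excess_cge s x y : excess s x - (num_ge s x)%:R * (y - x) <= excess s y.
Proof.
elim: s => [|z s IHs]; first by rewrite /excess /num_ge !big_nil /=; lra.
rewrite !excess_cons /num_ge /= natrD -/(num_ge s x).
case: (leP x z) => /= xz; rewrite /Num.max; do 2! case: ltP => ?; lra.
Qed.

Lemma excess_cgt s x y : excess s x - (num_gt s x)%:R * (y - x) <= excess s y.
Proof.
elim: s => [|z s IHs]; first by rewrite /excess /num_gt !big_nil /=; lra.
rewrite !excess_cons /num_gt /= natrD -/(num_gt s x).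
case: (ltP x z) => /= xz; rewrite /Num.max; do 2! case: ltP => ?; lra.
Qed.

Lemma excess_le s x y : x <= y -> excess s y <= excess s x.
Proof.
move=> xy; have := excess_cge s y x.
have : 0 <= (num_ge s y)%:R * (y - x) by rewrite mulr_ge0 ?subr_ge0.
lra.
Qed.

Lemma cgt_cge s x y : x < y -> (num_ge s y <= num_gt s x)%N.
Proof. by move=> xy; apply: sub_count => z /=; apply: lt_le_trans. Qed.

Lemma cge_le s x y : x <= y -> (num_ge s y <= num_ge s x)%N.
Proof. by move=> xy; apply: sub_count => z /=; apply: le_trans. Qed.

Lemma cgt_le s x y : x <= y -> (num_gt s y <= num_gt s x)%N.
Proof. by move=> xy; apply: sub_count => z /=; apply: le_lt_trans. Qed.

Lemma cgt_le_cge s x : (num_gt s x <= num_ge s x)%N.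
Proof. by apply: sub_count => z /=; apply: ltW. Qed.

Lemma cge_size s x : (num_ge s x <= size s)%N.
Proof. exact: count_size. Qed.

(** The right slope of the excess at such a [z] is its left slope at [u], hence
    a bound on the left slope at [u] gives a strict inequality between values at
    [z] and [u]. *)
Lemma gap_below s x u :
  x < u -> exists z, [/\ x <= z, z < u & (num_gt s z <= num_ge s u)%N].
Proof.
move=> xu; elim: s => [|y s [z [xz zu gap]]]; first by exists x.
have [uy|yu] := leP u y.
  by exists z; split; rewrite // /num_gt /num_ge /= uy (lt_le_trans zu uy).
exists (Num.max z y); rewrite le_max xz gt_max zu yu /num_gt /num_ge /=.
rewrite gt_max ltxx andbF /= leNgt yu /= add0n.
by split=> //; apply: leq_trans gap; apply: cgt_le; rewrite le_max lexx.
Qed.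

Lemma cge_gap s x y z :
  x <= y -> num_ge s x = num_ge s y -> z \in s -> x <= z -> y <= z.
Proof.
move=> xy eq_c zs xz; rewrite leNgt; apply/negP => zy.
have : (num_ge s y < num_ge s x)%N; last by rewrite eq_c ltnn.
elim: s zs {eq_c} => // w s IHs; rewrite inE /num_ge /= => /orP[/eqP<-|zs].
  by rewrite xz leNgt zy add0n add1n ltnS; apply: cge_le.
rewrite -addnS leq_add ?(IHs zs) //.
by case: (leP y w) => // /(le_trans xy) ->.
Qed.

(** Thresholds are extended reals so that the count also serves for half-open
    intervals whose ends may be infinite. *)
Definition num_geE s (e : \bar R) : nat := count (fun x => (e <= x%:E)%E) s.

Lemma num_geE_fin s x : num_geE s x%:E = num_ge s x.
Proof. by apply: eq_count => z; rewrite lee_fin. Qed.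

Lemma geE_lt_mem s (e f : \bar R) :
  (num_geE s f < num_geE s e)%N -> exists2 z, z \in s & (e <= z%:E < f)%E.
Proof.
move=> lt_c; apply/hasP; move: lt_c; apply: contraTT => /hasPn none.
rewrite -leqNgt; elim: s none => //= z s IHs none.
rewrite /num_geE /= leq_add //; last first.
  by apply: IHs => w ws; apply: none; rewrite inE ws orbT.
have := none z (mem_head _ _); rewrite negb_and -leNgt.
by case: (e <= _)%E => //= ->.
Qed.

Lemma cge_lt_mem s x y :
  (num_ge s y < num_ge s x)%N -> exists2 z, z \in s & x <= z < y.
Proof.
rewrite -!num_geE_fin => /geE_lt_mem[z zs]; rewrite lee_fin lte_fin => xzy.
by exists z.
Qed.

Lemma cgt_le_cge_next s x y :
  (forall z, z \in s -> x < z -> y <= z) -> (num_gt s x <= num_ge s y)%N.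
Proof.
elim: s => //= z s IHs next; rewrite /num_gt /num_ge /= leq_add //.
  by have := next z (mem_head _ _); case: (x < z) => // ->.
by apply: IHs => w ws; apply: next; rewrite inE ws orbT.
Qed.

Lemma excess_top s u : (forall z, z \in s -> z <= u) -> excess s u = 0.
Proof.
move=> top; apply: big1_seq => z /andP[_ zs].
by rewrite max_r // subr_le0 top.
Qed.

End Excess.

(** * The search for G_r *)

Section Search.

Variable R : realFieldType.
Implicit Types (b v : seq R) (x u rho t : R).

Lemma sum_below v u :
  all (fun x => x < u) v -> \sum_(x <- v) x <= (size v)%:R * u.
Proof.
elim: v => [|x v IHv] /=; first by rewrite big_nil mul0r.
case/andP=> xu /IHv; rewrite big_cons -natr1 => ?; lra.
Qed.

Lemma sum_strictly_below v u :
  all (fun x => x < u) v -> (0 < size v)%N ->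
  \sum_(x <- v) x < (size v)%:R * u.
Proof.
case: v => //= x v /andP[xu /sum_below]; rewrite big_cons -natr1 => ?; lra.
Qed.

(** [rho] solves the equation [excess v rho = H (u - rho)] as if all elements
    of [v] exceeded it. The last clause says that the elements of [b] left out
    of [v] contribute nothing to the excess from [rho] on, and the scans only
    ever increase [rho]. *)
Definition search_inv H u b v rho : Prop :=
  [/\ (H < size v)%N, all (fun x => x < u) v,
      ((size v)%:R - H%:R) * rho = \sum_(x <- v) x - H%:R * u
    & forall t, rho <= t -> excess v t = excess b t].

Lemma search_den_gt0 H v : (H < size v)%N -> 0 < (size v)%:R - H%:R :> R.
Proof. by move=> Hv; rewrite subr_gt0 ltr_nat. Qed.

Lemma search_init H u v :
  (H < size v)%N -> all (fun x => x < u) v ->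
  search_inv H u v v ((\sum_(x <- v) x - H%:R * u) / ((size v)%:R - H%:R)).
Proof.
move=> Hv vu; split=> //.
by rewrite mulrC divfK // gt_eqF ?search_den_gt0.
Qed.

Lemma search_skip H u b v rho x :
  search_inv H u b v rho -> x <= rho -> search_inv H u (rcons b x) v rho.
Proof.
case=> Hv vu eq_rho ex_v x_rho; split=> // t rho_t.
rewrite excess_rcons ex_v // max_r ?addr0 // subr_le0.
exact: le_trans x_rho rho_t.
Qed.

Lemma search_append H u b v rho x :
  search_inv H u b v rho -> rho < x -> x < u ->
  search_inv H u (rcons b x) (rcons v x)
    (rho + (x - rho) / ((size v).+1%:R - H%:R)).
Proof.
case=> Hv vu eq_rho ex_v rho_x xu.
have den_gt0 : 0 < (size v).+1%:R - H%:R :> R.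
  by rewrite -(size_rcons v x) search_den_gt0 // size_rcons ltnW.
split.
- by rewrite size_rcons ltnW.
- by rewrite all_rcons xu.
- rewrite size_rcons -cats1 big_cat big_seq1 /= mulrDr mulrCA divff ?gt_eqF //.
  move: eq_rho; rewrite -natr1 mulr1 => eq_rho; lra.
- move=> t rho_t; rewrite !excess_rcons ex_v //; apply: le_trans rho_t.
  by rewrite lerDl divr_ge0 ?(ltW den_gt0) ?subr_ge0 ?(ltW rho_x).
Qed.

(** Were only [H] elements left after removing [x <= rho], their sum would be
    at least [H u] by the equation for [rho], although each is below [u]. *)
Lemma search_remove_size H u b v1 v2 rho x :
  (0 < H)%N -> search_inv H u b (v1 ++ x :: v2) rho -> x <= rho ->
  (H < size (v1 ++ v2))%N.
Proof.
move=> H_gt0 [Hv vu eq_rho _] x_rho.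
have vu' : all (fun y => y < u) (v1 ++ v2).
  by move: vu; rewrite !all_cat /= => /and3P[-> _ ->].
have sz : size (v1 ++ x :: v2) = (size (v1 ++ v2)).+1.
  by rewrite !size_cat addnS.
rewrite ltn_neqAle -ltnS -sz Hv andbT; apply/eqP => eH.
have := @sum_strictly_below _ u vu'; rewrite -eH => /(_ H_gt0).
move: eq_rho; rewrite sz -eH -natr1 !big_cat big_cons /= => ? ?; lra.
Qed.

Lemma search_remove H u b v1 v2 rho x :
  (0 < H)%N -> search_inv H u b (v1 ++ x :: v2) rho -> x <= rho ->
  let rho' := rho + (rho - x) / ((size (v1 ++ v2))%:R - H%:R) in
  rho <= rho' /\ search_inv H u b (v1 ++ v2) rho'.
Proof.
move=> H_gt0 inv x_rho rho'.
have Hv' := search_remove_size H_gt0 inv x_rho.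
have den_gt0 := search_den_gt0 Hv'.
have rho_rho' : rho <= rho'.
  by rewrite lerDl divr_ge0 ?(ltW den_gt0) ?subr_ge0.
case: inv => Hv vu eq_rho ex_v; split=> //; split=> //.
- by move: vu; rewrite !all_cat /= => /and3P[-> _ ->].
- rewrite mulrDr mulrCA divff ?gt_eqF // mulr1.
  move: eq_rho; rewrite !size_cat /= addnS -natr1 !big_cat big_cons /= => ?.
  lra.
- move=> t rho_t; have rt := le_trans rho_rho' rho_t.
  rewrite -ex_v // !excess_cat excess_cons max_r ?add0r // subr_le0.
  exact: le_trans x_rho rt.
Qed.

Lemma search_rho_lt H u b v rho : search_inv H u b v rho -> rho < u.
Proof.
case=> Hv vu eq_rho _; have := sum_strictly_below vu (leq_ltn_trans _ Hv).
move=> /(_ isT) lt_sum; rewrite -subr_gt0.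
by rewrite -(pmulr_rgt0 _ (search_den_gt0 Hv)) mulrBr eq_rho; lra.
Qed.

Lemma search_final H u b v rho :
  search_inv H u b v rho -> all (fun x => rho < x) v ->
  excess b rho = H%:R * (u - rho).
Proof.
case=> _ _ eq_rho ex_v rho_v; rewrite -ex_v //.
have -> : excess v rho = \sum_(x <- v) x - (size v)%:R * rho.
  elim: v rho_v {eq_rho ex_v} => [|x v IHv] /=.
    by rewrite /excess !big_nil mul0r subr0.
  case/andP=> rho_x /IHv; rewrite excess_cons big_cons -natr1.
  by rewrite max_l ?subr_ge0 ?ltW // => ?; lra.
lra.
Qed.

Variable fuel : nat.

Lemma append_scan_runs H u b v rho l :
  all (fun x => x < u) l -> search_inv H u b v rho ->
  runs (foldC (append_scan H) (v, rho) l) fuel (6 * size l)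
    (fun st => search_inv H u (b ++ l) st.1 st.2 /\
               (size st.1 <= size v + size l)%N).
Proof.
move=> lu inv0.
pose Inv (st : seq R * R) l' := exists b', [/\ b ++ l = b' ++ l',
  all (fun x => x < u) l', search_inv H u b' st.1 st.2
  & (size st.1 + size l' <= size v + size l)%N].
have Inv0 : Inv (v, rho) l by exists b.
apply: runs_weaken (runs_foldC _ Inv0) _ _ => //; last first.
  by case=> v' rho' [b' /=]; rewrite cats0 addn0 => -[-> _].
case=> v' rho' x l' [b' [/= eq_b /andP[xu l'u] inv sz]].
apply: runs_bind_charge => //; case: ifP => rho_x.
- do 2 apply: runs_bind_charge => //.
  apply: runs_bind_divide => //.
    apply: lt0r_neq0; rewrite subr_gt0 ltr_nat; case: inv; lia.
  apply: runs_bind_charge => //; apply: runs_ret.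
  exists (rcons b' x); split=> //=; first by rewrite cat_rcons.
    exact: search_append.
  by rewrite size_rcons addSnnS.
- apply: runs_ret; exists (rcons b' x); split=> //=; last by lia.
    by rewrite cat_rcons.
  by apply: search_skip => //; rewrite leNgt rho_x.
Qed.

Lemma remove_pass_runs H u b v rho :
  (0 < H)%N -> search_inv H u b v rho ->
  runs (remove_pass H (v, rho)) fuel (6 * size v + 1)
    (fun o => match o with
     | inl st => (size st.1 < size v)%N /\ search_inv H u b st.1 st.2
     | inr rho' => search_inv H u b v rho' /\ all (fun x => rho' < x) v
     end).
Proof.
move=> H_gt0 inv0.
(* [sz = size v] characterizes a pass that has removed nothing so far. *)
pose Inv (st : seq R * nat * R) l := let: (kept, sz, rho') := st in
  [/\ sz = size (kept ++ l), (sz <= size v)%N,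
      search_inv H u b (kept ++ l) rho'
    & sz = size v -> [/\ rho' = rho, kept ++ l = v
                       & all (fun x => rho < x) kept]].
have Inv0 : Inv ([::], size v, rho) v by split.
rewrite /remove_pass; apply: (runs_bind (@runs_foldC _ _ _ _ 6 _ _ _ _ Inv0)).
- case=> [[kept sz] rho'] x l [sz_eq sz_le inv same].
  apply: runs_bind_charge => //; case: ifP => x_rho.
  + have [_ inv'] := search_remove H_gt0 inv x_rho.
    have Hv' := search_remove_size H_gt0 inv x_rho.
    have sz' : sz.-1 = size (kept ++ l) by rewrite sz_eq !size_cat addnS.
    do 3 apply: runs_bind_charge => //.
    rewrite sz'; apply: runs_bind_divide => //.
      by rewrite gt_eqF ?search_den_gt0.
    apply: runs_bind_charge => //; apply: runs_ret; split=> //.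
      by rewrite -sz'; lia.
    by move: sz_eq; rewrite !size_cat /= => ? ?; exfalso; lia.
  + apply: runs_ret; rewrite /Inv cat_rcons; split=> // /same[er ev kept_gt].
    by split=> //; rewrite all_rcons kept_gt andbT -er ltNge x_rho.
- by lia.
- case=> [[v' sz] rho'] [/=]; rewrite cats0 => sz_eq sz_le inv same.
  apply: runs_bind_charge; first by lia.
  apply: runs_ret; case: eqP => [/same[-> ev kept_gt] | neq] //=.
    by split; rewrite // -ev.
  by split=> //; lia.
Qed.

Lemma removal_runs H u b v rho n :
  (0 < H)%N -> search_inv H u b v rho -> (size v <= n)%N -> (n < fuel)%N ->
  runs (loop (remove_pass H) (v, rho)) fuel ((6 * n + 1) * n.+1)
    (fun rho' => rho' < u /\ excess b rho' = H%:R * (u - rho')).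
Proof.
move=> H_gt0 inv0 sz_n n_fuel.
apply: (@runs_loop _ _ _ _ (6 * n + 1)
  (fun j st => (size st.1 <= j)%N /\ search_inv H u b st.1 st.2) _ n) => //.
move=> j [v' rho'] le_j [/= sz inv].
apply: runs_weaken (remove_pass_runs H_gt0 inv) _ _; first by lia.
case=> [[v2 rho2] [lt_sz inv2] | rho2 [inv2 gt2]].
  by exists (size v2) => //; apply: leq_trans lt_sz sz.
by split; [apply: search_rho_lt inv2 | apply: search_final inv2 gt2].
Qed.

End Search.

(** * The functions F, phi and G *)

Section Analysis.

Variable R : realFieldType.
Variables (a : seq R) (k : nat) (r eps : R) (initN : nat -> seq R -> nat).
Hypothesis k_gt0 : (0 < k)%N.
Hypothesis k_lt : (k < size a)%N.
Hypothesis eps_ge0 : 0 <= eps.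
Hypothesis initN_ok : forall (H : nat) (b : seq R),
  (H < size b)%N -> (H < initN H b <= size b)%N.

Implicit Types (x y u l : R).

Local Notation n := (size a).
Local Notation kR := (k%:R : R).
Local Notation cge := (num_ge a).
Local Notation cgt := (num_gt a).

Let n_gt0 : (0 < n)%N. Proof. exact: leq_ltn_trans k_lt. Qed.

Let n_le_nn : (n <= n * n)%N. Proof. by rewrite leq_pmulr. Qed.

Let nn_le_nnn : (n * n <= n * n * n)%N. Proof. by rewrite leq_pmulr. Qed.

(* Cost inequalities follow from these bounds on [n] alone. *)
Local Ltac budget := clear -n_gt0 n_le_nn nn_le_nnn; lia.

Let kR_gt0 : 0 < kR. Proof. by rewrite ltr0n. Qed.

Let kR_neq0 : kR != 0. Proof. by rewrite gt_eqF. Qed.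

(** The entry of rank [k + 1] in nonincreasing order, where the slope of [phi]
    changes sign. *)
Definition next_entry : R := nth 0 (sort (fun x y => y <= x) a) k.
Local Notation A := next_entry.

Let dec := fun x y : R => y <= x.

Let dec_total : total dec. Proof. by move=> x y; apply: le_total. Qed.

Let dec_trans : transitive dec.
Proof. by move=> x y z yx zx; apply: le_trans zx yx. Qed.

Let nth_dec i j : (i <= j)%N -> (j < n)%N ->
  nth 0 (sort dec a) j <= nth 0 (sort dec a) i.
Proof.
move=> ij jn; have srt := sort_sorted dec_total a.
apply: (sorted_leq_nth dec_trans _ 0 srt) => //; rewrite ?inE ?size_sort //.
  by move=> x; rewrite /dec.
exact: leq_ltn_trans jn.
Qed.

Let count_sort (p : pred R) : count p a = count p (sort dec a).
Proof. by apply/permP; rewrite perm_sym perm_sort. Qed.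

Lemma cge_next_entry : (k < cge A)%N.
Proof.
rewrite /num_ge count_sort -[sort _ _](cat_take_drop k.+1) count_cat.
have : all (fun x => A <= x) (take k.+1 (sort dec a)).
  apply/(all_nthP 0) => i; rewrite size_take size_sort => lt_i.
  have ik : (i < k.+1)%N by move: lt_i; case: ifP => //; lia.
  by rewrite nth_take //; apply: nth_dec.
rewrite all_count size_take size_sort => e.
rewrite [X in (_ < X + _)%N](_ : _ = k.+1) ?leq_addr //.
by move/eqP: e => ->; case: ifP => //; lia.
Qed.

Lemma cgt_next_entry : (cgt A <= k)%N.
Proof.
rewrite /num_gt count_sort -[sort _ _](cat_take_drop k) count_cat.
have -> : count (fun x => A < x) (drop k (sort dec a)) = 0%N.
  apply/eqP; rewrite -leqn0 leqNgt -has_count; apply/negP.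
  case/(has_nthP 0) => i; rewrite size_drop size_sort => lt_i.
  rewrite nth_drop ltNge => /negP; apply.
  by apply: nth_dec; rewrite ?leq_addr // -ltn_subRL.
rewrite addn0; apply: leq_trans (count_size _ _) _.
by rewrite size_take size_sort; case: ifP => //; lia.
Qed.

Lemma lt_next_entry u : (A < u) = (cge u <= k)%N.
Proof.
have cA := cgt_next_entry; have cA' := cge_next_entry.
case: ltP => [lt_u | le_u]; first by have := cgt_cge a lt_u; lia.
by have := cge_le a le_u; lia.
Qed.

Definition F u : R := (r - excess a u) / kR.

(** The equation [g_r u l = 0] reads [phi u = phi l]. *)
Definition phi u : R := excess a u + kR * u.

Lemma phi_cge x y : phi x + (kR - (cge x)%:R) * (y - x) <= phi y.
Proof. have := excess_cge a x y; rewrite /phi; lra. Qed.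

Lemma phi_cgt x y : phi x + (kR - (cgt x)%:R) * (y - x) <= phi y.
Proof. have := excess_cgt a x y; rewrite /phi; lra. Qed.

Lemma F_cge x y : F y <= F x + (cge x)%:R / kR * (y - x).
Proof.
have -> : F x + (cge x)%:R / kR * (y - x)
          = (r - excess a x + (cge x)%:R * (y - x)) / kR by rewrite /F; field.
by rewrite ler_pM2r ?invr_gt0 //; have := excess_cge a x y; lra.
Qed.

Lemma F_cgt x y : F y <= F x + (cgt x)%:R / kR * (y - x).
Proof.
have -> : F x + (cgt x)%:R / kR * (y - x)
          = (r - excess a x + (cgt x)%:R * (y - x)) / kR by rewrite /F; field.
by rewrite ler_pM2r ?invr_gt0 //; have := excess_cgt a x y; lra.
Qed.

Lemma F_le x y : x <= y -> F x <= F y.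
Proof. by move=> xy; rewrite ler_pM2r ?invr_gt0 // lerB ?excess_le. Qed.

Lemma F_le_rk u : F u <= r / kR.
Proof. by rewrite ler_pM2r ?invr_gt0 // gerBl excess_ge0. Qed.

Lemma phi_dec x y : x < y -> y <= A -> phi y < phi x.
Proof.
move=> xy yA; have := phi_cge y x.
have : (k.+1%:R : R) <= (cge y)%:R.
  by rewrite ler_nat (leq_trans cge_next_entry) ?cge_le.
rewrite -natr1 => ? ?; nra.
Qed.

Lemma phi_inc x y : A <= x -> x <= y -> phi x <= phi y.
Proof.
move=> Ax xy; have := phi_cgt x y.
have : ((cgt x)%:R : R) <= kR.
  by rewrite ler_nat (leq_trans _ cgt_next_entry) ?cgt_le.
move=> ? ?; nra.
Qed.

Lemma phi_inc_strict x y :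
  A <= x -> x < y -> (cge y < k)%N -> phi x < phi y.
Proof.
move=> Ax xy cy; have [z [xz zy gap]] := gap_below a xy.
apply: le_lt_trans (phi_inc Ax xz) _; have := phi_cgt z y.
have : ((cgt z).+1%:R : R) <= kR by rewrite ler_nat (leq_ltn_trans gap).
rewrite -natr1 => ? ?; nra.
Qed.

(** [phi] decreases up to [A] and does not decrease from there on, so that the
    smallest [l] with [phi l = phi u] is the one at most [A]. *)
Definition is_G u : pred R := fun l => (l <= A) && (phi l == phi u).

Lemma is_G_inj u l1 l2 : is_G u l1 -> is_G u l2 -> l1 = l2.
Proof.
case/andP=> l1A /eqP e1 /andP[l2A /eqP e2].
by case: (ltgtP l1 l2) => // /phi_dec => [/(_ l2A) | /(_ l1A)];
  rewrite e1 e2 ltxx.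
Qed.

(** * The elementary evaluations *)

Section Evaluations.

Variable fuel : nat.

Lemma foldl_sum (f : R -> R) z s :
  foldl (fun t x => t + f x) z s = z + \sum_(x <- s) f x.
Proof.
by elim: s z => [|x s IHs] z /=; rewrite ?big_nil ?addr0 // big_cons IHs addrA.
Qed.

Lemma foldl_count (p : pred R) m s :
  foldl (fun t x => t + p x)%N m s = (m + count p s)%N.
Proof. by elim: s m => [|x s IHs] m /=; rewrite ?addn0 // IHs addnA. Qed.

Lemma sum_pos_runs u : runs (sum_pos a u) fuel (3 * n) (eq (excess a u)).
Proof.
apply: runs_weaken (runs_foldC_charge _ _ _ _ _) _ _ => // x <-.
by rewrite (foldl_sum (fun x => Num.max (x - u) 0)) add0r.
Qed.

Lemma evalF_runs u : runs (evalF a k r u) fuel (5 * n) (eq (F u)).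
Proof.
apply: (runs_bind_eq (sum_pos_runs u)); first by lia.
apply: runs_bind_charge; first by lia.
by apply: runs_divide => //; lia.
Qed.

Lemma evalg_runs u l : runs (evalg a k u l) fuel (10 * n) (eq (phi u - phi l)).
Proof.
apply: (runs_bind_eq (sum_pos_runs u)); first by lia.
apply: (runs_bind_eq (sum_pos_runs l)); first by lia.
by apply: runs_charge; [lia | rewrite /phi; ring].
Qed.

Lemma count_ge_runs u : runs (count_ge a u) fuel (2 * n) (eq (cge u)).
Proof.
apply: runs_weaken (runs_foldC_charge _ _ _ _ _) _ _ => // x <-.
by rewrite (foldl_count (fun x => u <= x)).
Qed.

Lemma count_gt_runs u : runs (count_gt a u) fuel (2 * n) (eq (cgt u)).
Proof.
apply: runs_weaken (runs_foldC_charge _ _ _ _ _) _ _ => // x <-.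
by rewrite (foldl_count (fun x => u < x)).
Qed.

Lemma count_between_runs u1 u2 :
  runs (count_between a u1 u2) fuel (3 * n)
    (eq (count (fun x => (u1 <= x) && (x < u2)) a)).
Proof.
apply: runs_weaken (runs_foldC_charge _ _ _ _ _) _ _ => // x <-.
by rewrite (foldl_count (fun x => (u1 <= x) && (x < u2))).
Qed.

Lemma extremum_runs (le : rel R) (P : pred R) :
  total le -> transitive le -> has P a ->
  runs (Defs.extremum a le P) fuel (2 * n)
    (fun y => [/\ y \in a, P y & forall z, z \in a -> P z -> le y z]).
Proof.
move=> le_tot le_tr has_P.
pose Inv (best : option R) (rest : seq R) := exists2 s, a = s ++ rest &
  match best with
  | Some y => [/\ y \in s, P y & forall z, z \in s -> P z -> le y z]
  | None => ~~ has P s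
  end.
have Inv0 : Inv None a by exists [::].
apply: (runs_bind (@runs_foldC _ _ _ _ 2 _ _ _ _ Inv0)) => //; last first.
  move=> best [s]; rewrite cats0 => <-; case: best => [y|] H.
    exact: runs_ret.
  by rewrite has_P in H.
move=> best x rest [s eq_a best_ok]; apply: runs_charge => //.
exists (rcons s x); first by rewrite cat_rcons.
have le_refl y : le y y by have := le_tot y y; rewrite orbb.
case: ifPn => [/andP[Px xbest] | worse].
  split; rewrite ?mem_rcons ?mem_head // => z; rewrite mem_rcons inE.
  case/orP=> [/eqP-> // | zs Pz].
  case: best best_ok xbest => [y [ys Py min_y] xy | /hasPn no_P _].
    exact: le_tr xy (min_y _ zs Pz).
  by have := no_P _ zs; rewrite Pz.
case: best best_ok worse => [y [ys Py min_y] worse | no_P].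
  split; rewrite ?mem_rcons ?inE ?ys ?orbT // => z; rewrite mem_rcons inE.
  case/orP=> [/eqP-> Px | zs Pz]; last exact: min_y.
  by move: worse; rewrite Px /=; have := le_tot x y => /orP[-> | ->].
by rewrite andbT has_rcons negb_or => ->.
Qed.

Lemma min_of_runs (P : pred R) : has P a ->
  runs (min_of a P) fuel (2 * n)
    (fun y => [/\ y \in a, P y & forall z, z \in a -> P z -> y <= z]).
Proof. by apply: extremum_runs; [apply: le_total | apply: le_trans]. Qed.

Lemma max_of_runs (P : pred R) : has P a ->
  runs (max_of a P) fuel (2 * n)
    (fun y => [/\ y \in a, P y & forall z, z \in a -> P z -> z <= y]).
Proof. by apply: extremum_runs; [apply: dec_total | apply: dec_trans]. Qed.

Definition below u : seq R := [seq x <- a | x < u].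

(** By this splitting, [phi l = phi u] amounts to the equation
    [excess (below u) l = (k - cge u) * (u - l)], which the search solves. *)
Lemma excess_split u l : l <= u ->
  excess a l = excess a u + (cge u)%:R * (u - l)
               + excess (below u) l.
Proof.
move=> lu; rewrite /below /num_ge; elim: a => [|x s IHs] /=.
  by rewrite /excess !big_nil; lra.
rewrite !excess_cons IHs natrD; case: (ltP x u) => xu /=.
  by rewrite excess_cons [Num.max (x - u) 0]max_r ?subr_le0 ?ltW //; lra.
rewrite !max_l ?subr_ge0 //; first lra.
exact: le_trans lu xu.
Qed.

Lemma size_below u : size (below u) = (n - cge u)%N.
Proof.
rewrite size_filter -(count_predC (fun x => u <= x)) addKn.
by apply: eq_count => x /=; rewrite ltNge.
Qed.

Lemma below_runs u :
  runs (foldC (fun s x => charge 1 (if x < u then rcons s x else s)) [::] a)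
    fuel n (eq (below u)).
Proof.
apply: runs_weaken (runs_foldC_charge _ _ _ _ _) _ _; first by rewrite mul1n.
suff gen s : foldl (fun s x => if x < u then rcons s x else s) s a
    = s ++ below u by move=> b <-; rewrite gen.
rewrite /below; elim: (a) s => [|x a' IHa] s /=; first by rewrite cats0.
by rewrite IHa; case: ifP => // _; rewrite cat_rcons.
Qed.

Lemma sum_runs (s : seq R) :
  runs (foldC (fun t x => charge 1 (t + x)) 0 s) fuel (size s)
    (eq (\sum_(x <- s) x)).
Proof.
apply: runs_weaken (runs_foldC_charge _ _ _ _ _) _ _; first by rewrite mul1n.
by move=> t <-; rewrite (foldl_sum id) add0r.
Qed.

(** If [cge u = k], then [phi] is constant on [[A, u]] and the next entry below
    [u] is [A]. If [cge u < k], the solution found by the search lies strictly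
    below [u], hence at most at [A], because [phi] stays below [phi u] on
    [[A, u)]. *)
Lemma evalG_is_G u : (n < fuel)%N ->
  runs (evalG a k initN u) fuel (32 * (n * n)) (is_G u).
Proof.
move=> n_fuel; apply: (runs_bind_eq (count_ge_runs u)); first by lia.
apply: runs_bind_charge; first by lia.
case: ltnP => [ku | uk].
  apply: runs_ret; rewrite /is_G eqxx andbT leNgt lt_next_entry -ltnNge.
  exact: ku.
have Au : A < u by rewrite lt_next_entry.
apply: runs_bind_charge; first by lia.
apply: runs_bind_charge; first by lia.
case: eqP => [H0 | /eqP H_neq0].
  have cgeu : cge u = k by lia.
  have lt_c := cge_next_entry; rewrite -cgeu in lt_c.
  have [z za /andP[Az zu]] := cge_lt_mem lt_c.
  have has_lt : has (fun x => x < u) a by apply/hasP; exists z.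
  apply: runs_weaken (max_of_runs has_lt) _ _ => [|l [la lu max_l]].
    by budget.
  have lA : l <= A.
    rewrite leNgt lt_next_entry -cgeu; apply/negP => le_c.
    have := cge_gap (ltW lu) _ la (lexx l); rewrite leNgt lu => H; apply/notF/H.
    by apply/eqP; rewrite eqn_leq le_c cge_le // ltW.
  have {lA}-> : l = A.
    by apply/eqP; rewrite eq_le lA (le_trans Az (max_l _ za zu)).
  rewrite /is_G lexx eq_le phi_inc ?(ltW Au) //=.
  by have := phi_cge u A; rewrite cgeu; lra.
have H_gt0 : (0 < k - cge u)%N by rewrite lt0n.
set H := (k - cge u)%N in H_gt0 *; set b := below u.
apply: (runs_bind_eq (below_runs u)); first by lia.
rewrite -/b.
have size_b : size b = (n - cge u)%N by apply: size_below.
have Hb : (H < size b)%N by rewrite size_b /H; lia.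
have /andP[HN Nb] := initN_ok Hb.
have b_lt : all (fun x => x < u) b by rewrite /b /below filter_all.
have size_v : size (take (initN H b) b) = initN H b.
  exact: size_takel.
have b_split := cat_take_drop (initN H b) b.
set v := take _ _ in size_v b_split *; set w := drop _ _ in b_split *.
have size_vw : (size v + size w)%N = size b by rewrite -size_cat b_split.
have /andP[v_lt w_lt] : all (fun x => x < u) v && all (fun x => x < u) w.
  by rewrite -all_cat b_split.
have Hv : (H < size v)%N by rewrite size_v.
have b_n : (size b <= n)%N by rewrite size_b leq_subr.
have v_n : (size v <= n)%N by apply: leq_trans b_n; rewrite -size_vw leq_addr.
have w_n : (size w <= n)%N.
  by apply: leq_trans b_n; rewrite -size_vw leq_addl.
apply: (runs_bind_eq (sum_runs v)); first by clear -n_gt0 n_le_nn v_n; lia.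
do 2 (apply: runs_bind_charge; first by clear -n_gt0 n_le_nn v_n; lia).
apply: runs_bind_divide.
- by rewrite gt_eqF ?search_den_gt0.
- by clear -n_gt0 n_le_nn v_n; lia.
have inv0 := search_init Hv v_lt.
apply: (runs_bind (append_scan_runs fuel w_lt inv0)).
  by clear -n_gt0 n_le_nn v_n w_n; lia.
rewrite b_split size_vw => -[v' rho'] [/= inv' size_v'].
have size_n := leq_trans size_v' b_n.
apply: runs_weaken (removal_runs H_gt0 inv' size_n n_fuel) _ _.
  by clear -n_gt0 n_le_nn v_n w_n; lia.
move=> l [lu ex_l].
have eq_phi : phi l = phi u.
  rewrite /phi (excess_split (ltW lu)) ex_l natrB //; ring.
rewrite /is_G eq_phi eqxx andbT leNgt; apply/negP => Al.
have := phi_inc_strict (ltW Al) lu; rewrite eq_phi ltxx => /(_ _)/notF; apply.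
by rewrite -subn_gt0.
Qed.

End Evaluations.

(** The search itself provides the solution of [phi l = phi u]. *)
Lemma ex_G u : exists l, is_G u l.
Proof.
by have [_ [l [_ _ Gl]]] := evalG_is_G u (leqnn n.+1); exists l.
Qed.

Definition G u : R := xchoose (ex_G u).

Lemma G_eq u l : is_G u l -> G u = l.
Proof. exact: is_G_inj (xchooseP (ex_G u)). Qed.

Lemma G_le u : G u <= A.
Proof. by have /andP[] := xchooseP (ex_G u). Qed.

Lemma phi_G u : phi (G u) = phi u.
Proof. by have /andP[_ /eqP] := xchooseP (ex_G u). Qed.

Lemma cge_G u : (k < cge (G u))%N.
Proof. exact: leq_trans cge_next_entry (cge_le a (G_le u)). Qed.

Lemma G_lt u l : l < G u -> phi u < phi l.
Proof. by move=> lG; rewrite -phi_G phi_dec ?G_le. Qed.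

Lemma G_ge u l : l <= A -> phi u <= phi l -> l <= G u.
Proof.
move=> lA le_phi; rewrite leNgt; apply/negP => Gl.
by have := phi_dec Gl lA; rewrite phi_G ltNge le_phi.
Qed.

Lemma G_anti x y : A <= x -> x <= y -> G y <= G x.
Proof.
by move=> Ax xy; rewrite G_ge ?G_le // phi_G phi_inc.
Qed.

(** The distance from [u] down to [G u] is controlled by the distance down to
    [A]: [phi] grows at rate at most [k] above [A], and decreases at rate at
    least [1] below it. *)
Lemma G_lower u : A <= u -> u - G u <= (kR + 1) * (u - A).
Proof.
move=> Au; have := phi_cge A (A - kR * (u - A)).
have : (k.+1%:R : R) <= (cge A)%:R by rewrite ler_nat cge_next_entry.
have := excess_le a Au; rewrite -natr1 => ex_le cA phi_le.
have : A - kR * (u - A) <= G u; last lra.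
have d_ge0 : 0 <= kR * (u - A) by rewrite mulr_ge0 ?subr_ge0 // ltW.
apply: G_ge; first by lra.
by apply: le_trans phi_le; rewrite /phi; nra.
Qed.

Definition D u : R := G u - F u.

(** Strict: either [phi] and hence [G] is strictly monotone before [y], or
    [cge y >= k] and [F] has a positive slope before [y]. *)
Lemma D_dec x y : A <= x -> x < y -> D y < D x.
Proof.
move=> Ax xy; have [ck | kc] := ltnP (cge y) k.
  apply: ltr_leB (F_le (ltW xy)); rewrite lt_neqAle G_anti ?(ltW xy) // andbT.
  apply/eqP => eG; have := phi_inc_strict Ax xy ck.
  by rewrite -(phi_G x) -(phi_G y) eG ltxx.
apply: ler_ltB; first exact: G_anti (ltW xy).
have cy : 0 < (cge y)%:R / kR by rewrite divr_gt0 ?ltr0n // (leq_trans k_gt0).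
have := F_cge y x; nra.
Qed.

Lemma D_anti x y : A <= x -> x <= y -> D y <= D x.
Proof.
by move=> Ax; rewrite le_eqVlt => /predU1P[-> // | /(D_dec Ax)/ltW].
Qed.

(** The decrease of [D] due to [F] alone. *)
Lemma D_gap x y :
  A <= x -> x <= y -> (cge y)%:R / kR * (y - x) <= D x - D y.
Proof.
move=> Ax xy; have := G_anti Ax xy; have := F_cge y x; rewrite /D; nra.
Qed.

Section EvaluationsD.

Variable fuel : nat.
Hypothesis n_fuel : (n < fuel)%N.

Lemma evalG_runs u :
  runs (evalG a k initN u) fuel (32 * (n * n)) (eq (G u)).
Proof. by apply: runs_weaken (evalG_is_G u n_fuel) _ _ => // l /G_eq. Qed.

Lemma evalD_runs u :
  runs (evalD a k r initN u) fuel (40 * (n * n)) (eq (D u)).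
Proof.
apply: (runs_bind_eq (evalG_runs u)); first by lia.
apply: (runs_bind_eq (evalF_runs fuel u)); first by lia.
by apply: runs_charge => //; lia.
Qed.

(** The right derivative of [D] at [u >= A]. *)
Definition dD u : R :=
  - ((kR - (cgt u)%:R) / ((cge (G u))%:R - kR)) - (cgt u)%:R / kR.

Lemma dD_den u : 0 < (cge (G u))%:R - kR :> R.
Proof. by rewrite subr_gt0 ltr_nat cge_G. Qed.

Lemma dD_lt0 u : A <= u -> dD u < 0.
Proof.
move=> Au; have := leq_trans (cgt_le a Au) cgt_next_entry.
rewrite /dD -opprD oppr_lt0 leq_eqVlt => /predU1P[-> | ck].
  by rewrite subrr mul0r add0r divff.
apply: ltr_wpDr; first by rewrite divr_ge0 // ltW.
by rewrite divr_gt0 ?dD_den // subr_gt0 ltr_nat.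
Qed.

Lemma evalD'_runs u :
  runs (evalD' a k initN u) fuel (50 * (n * n)) (eq (dD u)).
Proof.
apply: (runs_bind_eq (count_gt_runs fuel u)); first by lia.
apply: (runs_bind_eq (evalG_runs u)); first by lia.
apply: (runs_bind_eq (count_ge_runs fuel (G u))); first by lia.
do 2 (apply: runs_bind_charge; first by lia).
apply: runs_bind_divide; [by rewrite gt_eqF ?dD_den | by lia |].
apply: runs_bind_divide; [by [] | by lia |].
by apply: runs_charge => //; lia.
Qed.

End EvaluationsD.

(** * The Newton iteration of the exact step *)

(** As long as no entry lies strictly between [u] and [y], the function [F] is
    affine and [G], whose slope is [(cgt u - k) / (cge (G u) - k)], is convex on
    [[u, y]]. *)
Lemma D_tangent u y :
  A <= u -> u <= y -> (cge y <= cgt u)%N -> (cgt u <= cge y)%N ->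
  D u + dD u * (y - u) <= D y.
Proof.
move=> Au uy c1 c2; have ec : cge y = cgt u by apply/eqP; rewrite eqn_leq c1.
have := F_cgt u y; have den := dD_den u; rewrite /D /dD.
set t := (_ - (cgt u)%:R) / _; set f := _ / kR => Fy.
suff : G u - t * (y - u) <= G y by lra.
have t_ge0 : 0 <= t.
  rewrite divr_ge0 ?(ltW den) // subr_ge0 ler_nat.
  exact: leq_trans (cgt_le a Au) cgt_next_entry.
have tuy : 0 <= t * (y - u) by rewrite mulr_ge0 ?subr_ge0.
apply: G_ge; first by have := G_le u; lra.
have := phi_cge (G u) (G u - t * (y - u)); rewrite phi_G.
have := phi_cge y u; rewrite ec.
have -> : (kR - (cge (G u))%:R) * (G u - t * (y - u) - G u)
          = (kR - (cgt u)%:R) * (y - u).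
  by rewrite /t; field; rewrite gt_eqF.
lra.
Qed.

(** If [cge (G u)] does not change, the tangent is exact between [u] and the new
    point, which is then the zero. *)
Lemma newton_step u y (u' := u - D u / dD u) :
  A <= u -> 0 < D u -> u <= y -> (cgt u <= cge y)%N -> D y <= 0 ->
  [/\ u < u', u' <= y, 0 <= D u'
    & D u' = 0 \/ (cge (G u) < cge (G u'))%N].
Proof.
move=> Au Du_gt0 uy gap Dy_le0; have s_lt0 := dD_lt0 Au.
have lt_uy : u < y.
  rewrite lt_neqAle uy andbT; apply/eqP => e.
  by move: Dy_le0; rewrite -e leNgt Du_gt0.
have su' : dD u * (u' - u) = - D u.
  by rewrite /u'; field; rewrite lt_eqF.
have uu' : u < u'.
  by rewrite /u' ltrDl oppr_gt0 pmulr_rlt0 // invr_lt0.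
have gap_y : (cge y <= cgt u)%N by apply: cgt_cge.
have u'y : u' <= y.
  have := D_tangent Au uy gap_y gap; nra.
have gap1 : (cge u' <= cgt u)%N by apply: cgt_cge.
have gap2 : (cgt u <= cge u')%N by rewrite (leq_trans gap) ?cge_le.
have Du'_ge0 : 0 <= D u'.
  by have := D_tangent Au (ltW uu') gap1 gap2; rewrite su' subrr.
split=> //.
have G_le_G := G_anti Au (ltW uu').
have := cge_le a G_le_G; rewrite leq_eqVlt => /predU1P[eq_q|]; last by right.
left; apply/eqP; rewrite eq_le Du'_ge0 andbT.
have ec : cge u' = cgt u by apply/eqP; rewrite eqn_leq gap1.
have := F_cge u' u; rewrite ec => Fu.
have := phi_cge (G u') (G u); rewrite -eq_q !phi_G => phi1.
have phi2 := phi_cgt u u'.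
have den := dD_den u.
have Gu' : (kR - (cgt u)%:R) / ((cge (G u))%:R - kR) * (u' - u) <= G u - G u'.
  rewrite mulrAC ler_pdivrMr //; lra.
move: su'; rewrite /dD /D; lra.
Qed.

(** What the exact step needs of its starting point: either it stops at once, or
    no entry separates it from the zero, which lies at most at [y]. *)
Definition exact_start u : Prop :=
  `|D u| <= eps \/
  exists y, [/\ A <= u, 0 <= D u, u <= y, (cgt u <= cge y)%N & D y <= 0].

Lemma exact_runs fuel u : (n < fuel)%N -> exact_start u ->
  runs (loop (exact_body a k r eps initN) u) fuel (100 * (n * n) * n.+1)
    (fun _ => True).
Proof.
move=> n_fuel start.
pose Inv j x := exact_start x /\
  (D x = 0 \/ `|D x| <= eps \/ (n - cge (G x) < j)%N).
apply: (@runs_loop _ _ _ _ _ Inv) => //; last first.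
  split=> //; right; right.
  by have := cge_G u; have := cge_size a (G u); lia.
move=> j x le_j [start_x meas].
apply: (runs_bind_eq (evalD_runs n_fuel x)); first by budget.
apply: runs_bind_charge; first by budget.
case: ltP => [large | _]; last exact: runs_ret.
case: start_x => [|[y [Ax Dx xy gap Dy]]]; first by rewrite leNgt large.
have Dx_gt0 : 0 < D x.
  rewrite lt_neqAle Dx andbT; apply/eqP => Dx0.
  by move: large; rewrite -Dx0 normr0 ltNge eps_ge0.
apply: (runs_bind_eq (evalD'_runs n_fuel x)); first by budget.
apply: runs_bind_divide; [by rewrite lt_eqF ?dD_lt0 | by budget |].
apply: runs_bind_charge; first by budget.
have [xx' x'y Dx' prog] := newton_step Ax Dx_gt0 xy gap Dy.
set x' := x - _ in xx' x'y Dx' prog *; apply: runs_ret.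
have j_gt : (n - cge (G x) < j)%N.
  case: meas => [Dx0 | [small | //]]; first by rewrite Dx0 ltxx in Dx_gt0.
  by rewrite ltNge small in large.
have start' : exact_start x'.
  right; exists y; split=> //; first exact: le_trans (ltW xx').
  exact: leq_trans (cgt_le a (ltW xx')) gap.
case: prog => [Dx'0 | lt_q].
  by exists 0%N; [apply: leq_ltn_trans j_gt | split=> //; left].
exists (n - cge (G x')).+1; last by split=> //; right; right.
apply: leq_trans j_gt.
by rewrite ltnS ltn_sub2l // (leq_trans lt_q) ?cge_size.
Qed.

(** * The initialization step *)

Lemma left_dF_runs fuel (e : \bar R) :
  runs (left_dF a k e) fuel (3 * n) (eq ((num_geE a e)%:R / kR)).
Proof.
case: e => [x||] /=.
- apply: (runs_bind_eq (count_ge_runs fuel x)); first by budget.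
  by apply: runs_divide; rewrite ?num_geE_fin //; budget.
- apply: runs_ret; rewrite /num_geE (eq_count (a2 := pred0)) => [|x].
    by rewrite count_pred0 mul0r.
  by apply/negbTE; rewrite -ltNge ltry.
- apply: runs_divide => //; first by budget.
  rewrite /num_geE (eq_count (a2 := predT)) ?count_predT // => x.
  by rewrite /= leNye.
Qed.

Lemma slope_eq (m m' : nat) :
  (m%:R / kR == m'%:R / kR) = (m == m').
Proof. by rewrite (inj_eq (mulIf _)) ?invr_neq0 // eqr_nat. Qed.

Lemma slope_eq1 (m : nat) : (m%:R / kR == 1) = (m == k).
Proof. by rewrite -(inj_eq (mulIf kR_neq0)) divfK // mul1r eqr_nat. Qed.

Lemma slope_ge1 (m : nat) : (1 <= m%:R / kR) = (k <= m)%N.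
Proof. by rewrite ler_pdivlMr // mul1r ler_nat. Qed.

Lemma slope_gt1 (m : nat) : (1 < m%:R / kR) = (k < m)%N.
Proof. by rewrite ltr_pdivlMr // mul1r ltr_nat. Qed.

(** Where a current point [u] of the initialization comes from: it is the first
    one, or the zero of the tangent to [F - id] at the previous point. *)
Definition init_origin u (prev : option R) : Prop :=
  match prev with
  | None => u = r / kR
  | Some p => [/\ (cge p < k)%N, p <= r / kR, u < p, F p < p
                & p - F p = (1 - (cge p)%:R / kR) * (p - u)]
  end.

Definition left_init u (prev : option R) : Prop :=
  [/\ F u < u, (k <= cge u)%N & init_origin u prev].

(** [F - id] is concave, so the Newton iterates stay on the right of its zeros
    and the slope changes at each step, unless a zero is reached. *)
Lemma init_newton_step u
    (u' := (u * (cge u)%:R - kR * F u) / ((cge u)%:R - kR)) :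
  F u < u -> (cge u < k)%N ->
  [/\ u' < u, u - F u = (1 - (cge u)%:R / kR) * (u - u'), F u' <= u'
    & F u' = u' \/ (cge u < cge u')%N].
Proof.
move=> Fu cu; have den : (cge u)%:R - kR < 0 by rewrite subr_lt0 ltr_nat.
have tang : u - F u = (1 - (cge u)%:R / kR) * (u - u').
  by rewrite /u'; field; rewrite lt_eqF.
have slope : 0 < 1 - (cge u)%:R / kR.
  by rewrite subr_gt0 ltr_pdivrMr // mul1r ltr_nat.
have u'u : u' < u.
  rewrite -subr_gt0 -(pmulr_rgt0 _ slope) -tang; lra.
have Fu' : F u' <= u' by have := F_cge u u'; move: tang; lra.
split=> //; have := cge_le a (ltW u'u).
rewrite leq_eqVlt => /predU1P[ec | ]; last by right.
left; apply/eqP; rewrite eq_le Fu' /=.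
by have := F_cge u' u; rewrite -ec; move: tang; lra.
Qed.

Lemma init_runs fuel : (n < fuel)%N ->
  runs (loop (init_body a k r) (r / kR, None)) fuel (50 * n * n.+1)
    (fun o => if o is Leave u prev then left_init u prev else True).
Proof.
move=> n_fuel.
pose Inv j (st : R * option R) :=
  [/\ F st.1 <= st.1, init_origin st.1 st.2
    & F st.1 = st.1 \/ (k - cge st.1 <= j)%N].
apply: (@runs_loop _ _ _ _ _ Inv) => //; last first.
  split=> //=; first exact: F_le_rk.
  by right; clear -k_lt; lia.
move=> j [u prev] _ [/= Fu orig meas].
apply: (runs_bind_eq (evalF_runs fuel u)); first by budget.
apply: runs_bind_charge; first by budget.
case: eqP => [_ | /eqP Fu_neq]; first exact: runs_ret.
have {Fu}Fu : F u < u by rewrite lt_neqAle Fu_neq.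
have {}meas : (k - cge u <= j)%N by case: meas => // e; rewrite e ltxx in Fu.
apply: (runs_bind_eq (left_dF_runs fuel u%:E)); first by budget.
rewrite num_geE_fin slope_eq1.
apply: runs_bind_charge; first by budget.
apply: (@runs_bind _ _ _ _ _ _ (20 * n) (fun _ => True)).
- case: eqP => [eck | _]; last exact: runs_ret.
  have has_u : has (fun x => u <= x) a by rewrite has_count -/(cge u) eck.
  apply: (runs_bind (min_of_runs fuel has_u)); first by budget.
  move=> ak _; apply: (runs_bind_eq (evalF_runs fuel ak)); first by budget.
  apply: (runs_bind_eq (evalg_runs fuel _ _)); first by budget.
  by apply: runs_bind_charge; [budget | apply: runs_ret].
- by budget.
case=> [[ak fak] | ] _; first exact: runs_ret.
apply: runs_bind_charge; first by budget.
rewrite slope_ge1; case: leqP => [kc | ck]; first exact: runs_ret.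
apply: (runs_bind_eq (count_ge_runs fuel u)); first by budget.
do 2 (apply: runs_bind_charge; first by budget).
apply: runs_bind_divide; [by rewrite subr_eq0 eqr_nat ltn_eqF | by budget |].
apply: runs_ret; have [u'u tang Fu' prog] := init_newton_step Fu ck.
set u' := (_ * _ - _) / _ in u'u tang Fu' prog *.
have u_rk : u <= r / kR.
  by case: prev orig => [p [_ pr up _ _] | -> //]; apply: le_trans (ltW up) pr.
have orig' : init_origin u' (Some u) by [].
case: prog => [e | lt_c].
  by exists 0%N; [clear -meas ck; lia | split=> //; left].
by exists (k - cge u')%N; [clear -meas lt_c ck; lia | split=> //; right].
Qed.

(** [F - id] lies below two of its tangents: the one at [u], with a nonnegative
    slope, settles the points up to [u], and the one at the previous point,
    which vanishes at [u] and has a negative slope, those beyond [u]. *)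
Lemma infeasible u prev : left_init u prev -> forall x, F x < x.
Proof.
case=> Fu kc orig x; have [xu | ux] := leP x u.
  have := F_cge u x; have : 1 <= (cge u)%:R / kR by rewrite slope_ge1.
  by move=> ? ?; nra.
case: prev orig => [p [cp pr up Fp tang] | /= eu]; last first.
  by apply: le_lt_trans (F_le_rk x) _; rewrite -eu.
have := F_cge p x.
have : (cge p)%:R / kR < 1 by rewrite ltr_pdivrMr // mul1r ltr_nat.
by move: tang => ? ? ?; nra.
Qed.

(** * The bracketing of the root *)

Section Bracketing.

Hypothesis infeas : forall x, F x < x.

Lemma F_top u : (forall z, z \in a -> z <= u) -> F u = r / kR.
Proof. by move=> max_u; rewrite /F excess_top // subr0. Qed.

Lemma D_next_entry_gt0 : 0 < D A.
Proof.
have -> : D A = A - F A by rewrite /D (@G_eq A A) // /is_G lexx eqxx.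
by rewrite subr_gt0.
Qed.

Lemma D_le0_gt u : A <= u -> D u <= 0 -> A < u.
Proof.
rewrite le_eqVlt => /predU1P[<- | //].
by rewrite leNgt D_next_entry_gt0.
Qed.

Lemma D_le0_bound u : A <= u -> - D u <= (kR + 1) * (u - A).
Proof.
by move=> Au; have := G_lower Au; have := infeas u; rewrite /D; lra.
Qed.

(** A bound for [(uR - uC) / (uR - A)]; its logarithm bounds the number of
    bisections. The trial points are shifted from [uR] by at most
    [t (- D uR)] with [t <= 2 n], and [- D uR <= (k + 1) (uR - A)]. *)
Definition undershoot : R := (2 * n * n.+1)%:R.

Lemma undershoot_ge c h t :
  A < h -> h - c <= t * ((kR + 1) * (h - A)) -> t <= 2 * n%:R ->
  h - c <= undershoot * (h - A).
Proof.
move=> Ah le_c le_t; apply: le_trans le_c _.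
rewrite mulrA ler_pM2r ?subr_gt0 // /undershoot !natrM -[n.+1%:R]natr1.
have k1_ge0 : 0 <= kR + 1 by rewrite addr_ge0 // ltW.
apply: le_trans (ler_wpM2r k1_ge0 le_t) _.
by rewrite ler_wpM2l ?mulr_ge0 // lerD2r ler_nat ltnW.
Qed.

Definition lo_ok (lo : \bar R) : Prop :=
  match lo with
  | l%:E => A < l /\ 0 < D l
  | +oo%E => False
  | -oo%E => True
  end.

Definition hi_ok (hi : \bar R) : Prop :=
  match hi with
  | h%:E => A < h /\ D h < 0
  | +oo%E => True
  | -oo%E => False
  end.

(** Only with [uL = -oo] can the trial point lie below [A]: it is then
    extrapolated from the right, and the last clause bounds by how much it may
    miss [A]. *)
Definition bracket (st : pivot_state R) : Prop :=
  [/\ lo_ok (uL st), hi_ok (uR st), (uL st < (uC st)%:E < uR st)%E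
    & uL st = -oo%E -> exists h, [/\ uR st = h%:E, (0 < cge h)%N
        & h - uC st <= undershoot * (h - A)]].

(** In the second case the first trial point is the zero itself: this happens
    when [D uR = 0], and then [uC = uR]. *)
Definition started (st : pivot_state R) : Prop :=
  bracket st \/ A < uC st /\ D (uC st) = 0.

(** * The starting points of the pivot step *)

(** Since [F p < p], the value [phi (F p)] can exceed [phi p] only if [F p] lies
    to the left of [G p]. *)
Lemma phi_F_lt p : A < p -> phi p < phi (F p) -> 0 < D p.
Proof.
move=> Ap lt_phi; rewrite subr_gt0 ltNge; apply/negP => GF.
move: lt_phi; rewrite ltNge => /negP; apply.
have [FA | AF] := leP (F p) A.
  move: GF; rewrite le_eqVlt => /predU1P[<- | /phi_dec/(_ FA)/ltW].
    by rewrite phi_G.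
  by rewrite phi_G.
exact: phi_inc (ltW AF) (ltW (infeas p)).
Qed.

Lemma phi_F_ge p : phi (F p) <= phi p -> D p <= 0.
Proof.
move=> le_phi; rewrite subr_le0 leNgt; apply/negP => /G_lt.
by rewrite ltNge le_phi.
Qed.

Lemma start_flag23_runs fuel u p : (n < fuel)%N -> left_init u (Some p) ->
  runs (start_flag23 a k r initN u p) fuel (80 * (n * n)) started.
Proof.
move=> n_fuel [_ _ [cp pr up Fp _]].
have Ap : A < p by rewrite lt_next_entry ltnW.
have m_gt0 : (0 < cge p)%N.
  rewrite lt0n; apply/eqP => c0; move: Fp.
  rewrite F_top ?ltNge ?pr // => z za; rewrite leNgt; apply/negP => pz.
  have : (0 < cge p)%N; last by rewrite c0.
  by rewrite -has_count; apply/hasP; exists z => //; apply: ltW.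
have mR_gt0 : 0 < (cge p)%:R :> R by rewrite ltr0n.
apply: (runs_bind_eq (evalF_runs fuel p)); first by budget.
apply: (runs_bind_eq (evalg_runs fuel p _)); first by budget.
apply: runs_bind_charge; first by budget.
apply: (runs_bind_eq (evalD_runs n_fuel p)); first by budget.
apply: (runs_bind_eq (count_ge_runs fuel p)); first by budget.
apply: runs_bind_charge; first by budget.
apply: runs_bind_divide; [by rewrite gt_eqF | by budget |].
apply: runs_bind_charge; first by budget.
rewrite subr_lt0; case: ltP => [/(phi_F_lt Ap) Dp | /phi_F_ge Dp].
- apply: runs_bind_charge; first by budget.
  apply: runs_ret; left; split=> //=; rewrite ltry andbT lte_fin.
  have : 0 < kR * D p / (cge p)%:R by rewrite divr_gt0 ?mulr_gt0.
  lra.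
apply: runs_bind_charge; first by budget.
apply: runs_ret; have [D0 | Dneq] := eqVneq (D p) 0.
  right; rewrite /= D0 mulr0 mul0r addr0 max_l ?(ltW up) //.
  by have -> : (p + p) / 2 = p by lra.
have Dlt : D p < 0 by rewrite lt_neqAle Dneq.
have shift : kR * D p / (cge p)%:R < 0.
  by rewrite pmulr_llt0 ?invr_gt0 // pmulr_rlt0.
set u'' := p + _ / _; have u''p : u'' < p by rewrite /u''; lra.
have max_p : Num.max u'' u < p by rewrite gt_max u''p up.
have max_u'' : u'' <= Num.max u'' u by rewrite le_max lexx.
move: (Num.max u'' u) max_p max_u'' => w w_p w_u''.
left; split=> //=; first by rewrite ltNyr lte_fin; lra.
move=> _; exists p; split=> //.
apply: (@undershoot_ge _ _ (kR / (cge p)%:R)) => //.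
  have := D_le0_bound (ltW Ap).
  rewrite -(ler_pM2l (divr_gt0 kR_gt0 mR_gt0)); move: w_u''.
  by rewrite /u''; lra.
rewrite ler_pdivrMr //.
have : kR <= n%:R by rewrite ler_nat ltnW.
have : 1 <= (cge p)%:R :> R by rewrite ler1n.
by move: kR_gt0 => ? ? ?; nra.
Qed.

Section Start.

Variable top : R.
Hypothesis top_in : top \in a.
Hypothesis top_max : forall z, z \in a -> z <= top.

Lemma next_entry_le_top : A <= top.
Proof.
have : has (fun x => A <= x) a.
  by rewrite has_count (leq_trans _ cge_next_entry).
by case/hasP=> z /top_max le_top Az; apply: le_trans Az le_top.
Qed.

(** Here [F top = r / k], and [G top > r / k] would give
    [phi top < phi (r / k)]. *)
Lemma D_top_first u :
  left_init u None -> 0 <= phi top - phi (F top) -> D top <= 0.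
Proof.
case=> _ _ _; rewrite /D F_top // subr_ge0 subr_le0 => le_phi.
by rewrite leNgt; apply/negP => /G_lt; rewrite ltNge le_phi.
Qed.

(** [G top <= A < p <= r / k = F top]. *)
Lemma D_top_later u p : left_init u (Some p) -> D top <= 0.
Proof.
case=> _ _ [cp pr _ _ _]; rewrite /D F_top // subr_le0.
have Ap : A < p by rewrite lt_next_entry ltnW.
by apply: le_trans (G_le top) _; apply: le_trans (ltW Ap) pr.
Qed.

Lemma start_flag1_runs fuel : (n < fuel)%N -> D top <= 0 ->
  runs (start_flag1 a k r initN top) fuel (80 * (n * n)) started.
Proof.
move=> n_fuel D_top; have A_top := D_le0_gt next_entry_le_top D_top.
apply: (runs_bind_eq (evalD_runs n_fuel top)); first by budget.
apply: (runs_bind_eq (evalG_runs n_fuel top)); first by budget.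
apply: (runs_bind (count_between_runs fuel _ _)); first by budget.
move=> m m_eq.
apply: runs_bind_charge; first by budget.
apply: runs_bind_divide; [by [] | by budget |].
apply: runs_bind_charge; first by budget.
apply: runs_ret; have [D0 | Dneq] := eqVneq (D top) 0.
  by right; rewrite /= D0 !mul0r addr0.
have m_n : m%:R <= n%:R :> R by rewrite ler_nat -m_eq count_size.
have m_gt0 : 0 < m%:R :> R.
  (* an entry in [[A, top)], without which the trial point would be [top] *)
  have lt_c : (cge top < cge A)%N.
    by apply: leq_ltn_trans cge_next_entry; rewrite -lt_next_entry.
  have [z za /andP[Az ztop]] := cge_lt_mem lt_c.
  rewrite ltr0n -m_eq -has_count; apply/hasP; exists z => //.
  by rewrite ztop (le_trans (G_le top) Az).
have Dlt : D top < 0 by rewrite lt_neqAle Dneq.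
have shift : 0 < - D top * m%:R / kR.
  by rewrite divr_gt0 ?mulr_gt0 ?oppr_gt0.
left; split=> //=.
- by rewrite ltNyr lte_fin; lra.
- move=> _; exists top; split=> //.
    by rewrite -has_count; apply/hasP; exists top.
  apply: (@undershoot_ge _ _ (m%:R / kR)) => //.
    have := D_le0_bound (ltW A_top).
    rewrite -(ler_pM2l (divr_gt0 m_gt0 kR_gt0)); lra.
  have : m%:R / kR <= m%:R :> R.
    by rewrite ler_pdivrMr // ler_peMr ?(ltW m_gt0) // ler1n.
  by move: m_gt0; lra.
Qed.

End Start.

(** * Bisection *)

Lemma undershoot_lt : undershoot < 2 ^+ (2 * n + 2).
Proof.
rewrite /undershoot -natrX ltr_nat.
have n_exp := ltn_expl n (ltnSn 1); have := leq_mul (ltnW n_exp) n_exp.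
have -> : (2 ^ (2 * n + 2) = 4 * (2 ^ n * 2 ^ n))%N.
  by rewrite expnD mulnC mul2n -addnn expnD.
by move: n_exp; clear; move: (2 ^ n)%N => m; nia.
Qed.

(** Each bisection halves [uR - c], which starts below
    [2 ^ (2 n + 2) (uR - A)]; the loop exits when it falls under [uR - A]. *)
Lemma P1_runs fuel lo hi c lb rb :
  (2 * n + 2 < fuel)%N -> bracket (Pivot c lo hi lb rb) ->
  runs (loop (P1_body a k hi) c) fuel (6 * n * (2 * n + 2).+1)
    (fun c' => [/\ A < c', c <= c' & (c'%:E < hi)%E]).
Proof.
move=> n_fuel [/= lo_c hi_c /andP[lo_lt c_hi] below].
pose Inv j x := [/\ c <= x, (x%:E < hi)%E
  & A < x \/ exists2 h, hi = h%:E & h - x < 2 ^+ j * (h - A)].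
have Ainv x h : h - x < h - A -> A < x by lra.
apply: (@runs_loop _ _ _ _ _ Inv) => //; last first.
  split=> //; case: lo lo_c lo_lt below => [l [Al _] | // | _ _ /(_ erefl)].
    by rewrite lte_fin => /(lt_trans Al); left.
  case=> h [eh _ ge_c]; right; exists h => //; apply: le_lt_trans ge_c _.
  have [Ah _] : hi_ok h%:E by rewrite -eh.
  by rewrite ltr_pM2r ?subr_gt0 // undershoot_lt.
move=> j x _ [cx x_hi far].
apply: (runs_bind_eq (left_dF_runs fuel x%:E)); first by budget.
rewrite num_geE_fin; apply: runs_bind_charge; first by budget.
rewrite slope_gt1; case: ltnP => [kc | ck]; last first.
  by apply: runs_ret; split; rewrite ?lt_next_entry.
have xA : x <= A by rewrite leNgt lt_next_entry -ltnNge.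
case: far => [| [h eh near]]; first by rewrite ltNge xA.
rewrite eh in x_hi *; apply: runs_bind_ret.
apply: runs_bind_charge; first by budget.
apply: runs_ret; rewrite lte_fin in x_hi.
case: j near => [|j near].
  by rewrite expr0 mul1r => /Ainv; rewrite ltNge xA.
exists j => //; split; rewrite ?eh ?lte_fin; [lra | lra |].
by right; exists h => //; move: near; rewrite exprS; lra.
Qed.

(** * The pivot iteration *)

Section Pivot.

Variable top : R.
Hypothesis top_in : top \in a.
Hypothesis top_max : forall z, z \in a -> z <= top.
Hypothesis D_top : D top <= 0.

(** Guarantees that the minimum over the entries above a trial point is taken
    over a nonempty set. *)
Lemma entry_above u : A <= u -> 0 < D u -> exists2 z, z \in a & u < z.
Proof.
move=> Au Du; exists top => //; rewrite ltNge; apply/negP => top_u.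
by rewrite ltNge (le_trans (D_anti (next_entry_le_top top_max) top_u)) in Du.
Qed.

Lemma D_lt_inv x y : A <= x -> D x < D y -> y < x.
Proof.
by move=> Ax; rewrite ltNge; apply: contraNlt => /(D_anti Ax).
Qed.

Lemma count_lt (p q : pred R) s z :
  subpred p q -> z \in s -> q z -> ~~ p z -> (count p s < count q s)%N.
Proof.
move=> pq zs qz npz; elim: s zs => //= x s IHs.
rewrite inE => /predU1P[<- | zs].
  by rewrite qz (negbTE npz) add0n add1n ltnS sub_count.
rewrite -addnS leq_add ?IHs //.
by case px: (p x) => //; rewrite (pq _ px).
Qed.

(** The number of pivot iterations is bounded by counting the entries both in
    [[lo, hi)] and in [(lo, hi)]: moving an end to a trial point removes an
    entry from the former, unless the trial point had been moved to an entry,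
    which then leaves one of the two. *)
Definition potential (lo hi : \bar R) : nat :=
  (count (fun x => (lo <= x%:E < hi)%E) a
   + count (fun x => (lo < x%:E < hi)%E) a)%N.

Lemma potential_le lo hi : (potential lo hi <= 2 * n)%N.
Proof. by rewrite mul2n -addnn leq_add ?count_size. Qed.

Lemma potential_lt lo hi lo' hi' z :
  (lo <= lo')%E -> (hi' <= hi)%E -> z \in a ->
  (lo <= z%:E < hi)%E && ~~ (lo' <= z%:E < hi')%E
  || (lo < z%:E < hi)%E && ~~ (lo' < z%:E < hi')%E ->
  (potential lo' hi' < potential lo hi)%N.
Proof.
move=> le_lo le_hi za.
have sub1 : subpred (fun x => (lo' <= x%:E < hi')%E)
                    (fun x => (lo <= x%:E < hi)%E).
  by move=> x /andP[/(le_trans le_lo)-> /lt_le_trans->].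
have sub2 : subpred (fun x => (lo' < x%:E < hi')%E)
                    (fun x => (lo < x%:E < hi)%E).
  by move=> x /andP[/(le_lt_trans le_lo)-> /lt_le_trans->].
case/orP=> /andP[z1 z2].
  by rewrite /potential -addSn leq_add ?(count_lt sub1 za) ?sub_count.
by rewrite /potential -addnS leq_add ?(count_lt sub2 za) ?sub_count.
Qed.

(** What remains of [bracket] once the bisections have raised the trial point
    above [A]. *)
Definition trial (st : pivot_state R) : Prop :=
  [/\ A < uC st, lo_ok (uL st), hi_ok (uR st), (uL st < (uC st)%:E < uR st)%E
    & uL st = -oo%E -> exists2 h, uR st = h%:E & (0 < cge h)%N].

Definition next_lo (st : pivot_state R) : \bar R :=
  if 0 < D (uC st) then (uC st)%:E else uL st.

Definition next_hi (st : pivot_state R) : \bar R :=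
  if D (uC st) < 0 then (uC st)%:E else uR st.

Lemma generate_runs fuel x y : (n < fuel)%N -> D x != D y ->
  runs (generate a k r initN x%:E y%:E) fuel (90 * (n * n))
    (eq ((- x * D y + y * D x) / (- D y + D x))).
Proof.
move=> n_fuel Dxy; do 2 apply: runs_bind_ret.
apply: (runs_bind_eq (evalD_runs n_fuel x)); first by budget.
apply: (runs_bind_eq (evalD_runs n_fuel y)); first by budget.
do 2 (apply: runs_bind_charge; first by budget).
by apply: runs_divide => //; [rewrite addrC subr_eq0 | budget].
Qed.

Lemma secantE (x y dx dy : R) : dx != dy ->
  (- x * dy + y * dx) / (- dy + dx) = y + dy * (y - x) / (dx - dy).
Proof. by move=> ne; field; rewrite subr_eq0. Qed.

Lemma secant_between (x y dx dy : R) : x < y -> dy < 0 -> 0 < dx ->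
  x < (- y * dx + x * dy) / (- dx + dy) < y.
Proof.
move=> xy dy0 dx0; rewrite secantE ?lt_eqF ?(lt_trans dy0) //.
have -> : x + dx * (x - y) / (dy - dx) = x + dx / (dx - dy) * (y - x).
  by field; lra.
have t0 : 0 < dx / (dx - dy) by rewrite divr_gt0 // subr_gt0 (lt_trans dy0).
have t1 : dx / (dx - dy) < 1 by rewrite ltr_pdivrMr; lra.
apply/andP; split; nra.
Qed.

Lemma secant_right (x y dx dy : R) : x < y -> dy < dx -> 0 < dy ->
  y < (- x * dy + y * dx) / (- dy + dx).
Proof.
move=> xy dxy dy0; rewrite secantE ?gt_eqF // ltrDl.
by rewrite divr_gt0 ?mulr_gt0 ?subr_gt0.
Qed.

Lemma secant_left (x y dx dy : R) : y < x -> dx < dy -> dy < 0 ->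
  (- x * dy + y * dx) / (- dy + dx) < y.
Proof.
move=> xy dxy dy0; rewrite secantE ?lt_eqF //.
have : 0 < - dy * (x - y) / (dy - dx).
  by rewrite divr_gt0 ?mulr_gt0 ?subr_gt0 ?oppr_gt0.
have -> : - dy * (x - y) / (dy - dx) = - (dy * (y - x) / (dx - dy)).
  by field; lra.
lra.
Qed.

(** Extrapolating to the left of [y] from [y < x], the secant undershoots by
    at most [k (- D y)], because [D] decreases there at rate at least
    [1 / k]. *)
Lemma secant_undershoot x y :
  A < y -> y < x -> (0 < cge x)%N -> D y < 0 ->
  y - (- x * D y + y * D x) / (- D y + D x) <= undershoot * (y - A).
Proof.
move=> Ay yx cx Dy; have Dxy := D_dec (ltW Ay) yx.
rewrite secantE ?lt_eqF //.
have den : 0 < D y - D x by lra.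
apply: (@undershoot_ge _ _ kR) => //.
  have -> : y - (y + D y * (y - x) / (D x - D y))
            = - D y * ((x - y) / (D y - D x)) by field; lra.
  have bound := D_le0_bound (ltW Ay).
  (* the entries at [x] give [F], hence [- D], a slope of at least [1 / k] *)
  have rate : (x - y) / (D y - D x) <= kR.
    rewrite ler_pdivrMr //; have := D_gap (ltW Ay) (ltW yx).
    rewrite mulrAC ler_pdivrMr //.
    have : 1 <= (cge x)%:R :> R by rewrite ler1n.
    by move=> ? ?; nra.
  have Dy_ge0 : 0 <= - D y by lra.
  apply: le_trans (ler_wpM2l Dy_ge0 rate) _.
  by rewrite mulrC ler_pM2l.
have : kR <= n%:R by rewrite ler_nat ltnW.
have : 0 <= n%:R :> R by [].
lra.
Qed.

(** The ends of the bracket follow the sign of [D] at the trial point, and the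
    secant through the two points that the iteration keeps meets zero strictly
    inside the new bracket, between them or beyond the more recent one. *)
Lemma P4_P5_runs fuel st : (n < fuel)%N -> trial st -> D (uC st) != 0 ->
  runs (let! st3 := P4 st (D (uC st)) in
        let! st4 := P5 a k r initN st3 in ret (inl st4)) fuel (100 * (n * n))
    (fun o : pivot_state R + \bar R => exists st4, [/\ o = inl st4, bracket st4,
       uL st4 = next_lo st & uR st4 = next_hi st]).
Proof.
move=> n_fuel; case: st => c lo hi lb rb; rewrite /trial /next_lo /next_hi /=.
case=> Ac lo_c hi_c /andP[lo_lt lt_hi] below Dc.
have fin x y hi' lo' lb' rb' : D x != D y ->
    (forall c', c' = (- x * D y + y * D x) / (- D y + D x) ->
       bracket (Pivot c' lo' hi' lb' rb')) ->
    runs (let! c' := generate a k r initN x%:E y%:E in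
          ret (Pivot c' lo' hi' lb' rb')) fuel (95 * (n * n))
      (fun st4 => [/\ bracket st4, uL st4 = lo' & uR st4 = hi']).
  move=> Dxy H; apply: (runs_bind_eq (generate_runs n_fuel Dxy)).
    by budget.
  by apply: runs_ret; split=> //; apply: H.
apply: runs_bind_charge; first by budget.
have wrap p lo' hi' :
    runs (P5 a k r initN p) fuel (95 * (n * n))
      (fun st4 => [/\ bracket st4, uL st4 = lo' & uR st4 = hi']) ->
    runs (let! st4 := P5 a k r initN p in ret (inl st4)) fuel
      (100 * (n * n) - 2)
      (fun o : pivot_state R + \bar R => exists st4,
         [/\ o = inl st4, bracket st4, uL st4 = lo' & uR st4 = hi']).
  move=> r5; apply: (runs_bind r5); first by budget.
  by move=> st4 [b4 l4 h4]; apply: runs_ret; exists st4.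
apply: wrap.
have [Dlt | Dgt | D0] := ltgtP (D c) 0; last by rewrite D0 eqxx in Dc.
- case: lo lo_c lo_lt below => [l [Al Dl] lc _ | // | _ _ /(_ erefl)[h eh ch]].
  + have Dl_c : D c < D l by apply: lt_trans Dl.
    have -> : (if hi == +oo%E then Pivot c l%:E c%:E lb rb
               else if l%:E == -oo%E then Pivot c l%:E c%:E lb hi
               else Pivot c l%:E c%:E lb rb) = Pivot c l%:E c%:E lb rb.
      by case: ifP.
    apply: fin => [|_ ->]; first by rewrite lt_eqF.
    by split=> //=; rewrite !lte_fin secant_between.
  + rewrite eh /= in hi_c lt_hi *; case: hi_c => Ah Dh.
    rewrite lte_fin in lt_hi; have Dhc := D_dec (ltW Ac) lt_hi.
    apply: fin => [|_ ->]; first by rewrite lt_eqF.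
    split=> //=; first by rewrite ltNyr lte_fin secant_left.
    move=> _; exists c; split=> //; last exact: secant_undershoot.
    exact: leq_trans ch (cge_le a (ltW lt_hi)).
- case: hi hi_c lt_hi below => [h [Ah Dh] ch _ | _ _ below | //].
  + have Dh_c : D h < D c by apply: lt_trans Dh Dgt.
    have -> : (if h%:E == +oo%E then Pivot c c%:E h%:E lo rb
               else if lo == -oo%E then Pivot c c%:E h%:E lb rb
               else Pivot c c%:E h%:E lb rb) = Pivot c c%:E h%:E lb rb.
      by case: ifP.
    apply: fin => [|_ ->]; first by rewrite lt_eqF.
    by split=> //=; rewrite !lte_fin secant_between.
  + case: lo lo_c lo_lt below => [l [Al Dl] lc _ | // | _ _ /(_ erefl)[]//].
    rewrite lte_fin in lc; have Dcl := D_dec (ltW Al) lc.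
    apply: fin => [|_ ->]; first by rewrite gt_eqF.
    by split=> //=; rewrite ltry andbT lte_fin secant_right.
Qed.

Lemma num_geE_le (e f : \bar R) : (e <= f)%E -> (num_geE a f <= num_geE a e)%N.
Proof. by move=> ef; apply: sub_count => z /=; apply: le_trans. Qed.

Lemma hi_ok_gt hi x : hi_ok hi -> 0 < D x -> (x%:E < hi)%E.
Proof.
case: hi => [h [Ah Dh] Dx| _ _ | //]; last by rewrite ltry.
by rewrite lte_fin D_lt_inv ?(ltW Ah) // (lt_trans Dh).
Qed.

Lemma lo_ok_lt lo x : lo_ok lo -> A <= x -> D x < 0 -> (lo < x%:E)%E.
Proof.
case: lo => [l [Al Dl] Ax Dx| // | _ _ _]; last by rewrite ltNyr.
by rewrite lte_fin D_lt_inv // (lt_trans Dx).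
Qed.

(** No entry lies between the trial point and one of the ends when the slopes
    of F agree, so that either the exact step may start, or the trial point
    moves to the next entry; otherwise entries lie on both sides of it. *)
Lemma P3_runs fuel st : (n < fuel)%N -> trial st -> D (uC st) != 0 ->
  runs (P3 a k r initN st (D (uC st))) fuel (60 * (n * n))
    (fun o => match o with
     | inr e => exists2 x, e = x%:E & exact_start x
     | inl (st', d) => [/\ d = D (uC st'), trial st', D (uC st') != 0
         & (potential (next_lo st') (next_hi st')
              < potential (uL st) (uR st))%N]
     end).
Proof.
move=> n_fuel; case: st => c lo hi lb rb.
rewrite /trial /=; case=> Ac lo_c hi_c /andP[lo_lt lt_hi] below Dc.
apply: (runs_bind_eq (left_dF_runs fuel c%:E)); first by budget.
apply: (runs_bind_eq (left_dF_runs fuel lo)); first by budget.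
rewrite num_geE_fin slope_eq.
apply: runs_bind_charge; first by budget.
case: eqP => [eqL | /eqP neqL].
- case: lo lo_c lo_lt below eqL => [l [Al Dl] lc _ | // | _ _ _]; last first.
    rewrite /num_geE (eq_count (a2 := predT)) ?count_predT => [ec | x].
      by move: Ac; rewrite lt_next_entry ec leqNgt k_lt.
    by rewrite /= leNye.
  rewrite num_geE_fin => eqL; rewrite lte_fin in lc.
  apply: runs_bind_charge; first by budget.
  case: ltP => [Dc_gt0 | Dc_le0]; last first.
    apply: runs_bind_ret; apply: runs_bind_charge; first by budget.
    rewrite /= Dc_le0; apply: runs_ret; exists l => //; right; exists c.
    by split; rewrite ?(ltW Al) ?(ltW Dl) ?(ltW lc) // eqL cgt_le_cge.
  have [z za cz] := entry_above (ltW Ac) Dc_gt0.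
  have has_c : has (fun x => c < x) a by apply/hasP; exists z.
  pose Q (new : pivot_state R * R) := exists c', [/\ c' \in a, c < c',
    forall y, y \in a -> c < y -> c' <= y
    & new = (Pivot c' c%:E hi lb rb, D c')].
  apply: (@runs_bind _ _ _ _ _ _ (42 * (n * n)) Q).
  + apply: (runs_bind (min_of_runs fuel has_c)); first by budget.
    move=> c' [c'a cc' min_c'].
    apply: (runs_bind_eq (evalD_runs n_fuel c')); first by budget.
    by apply: runs_ret; exists c'.
  + by budget.
  move=> _ [c' [c'a cc' min_c' ->]].
  apply: runs_bind_charge; first by budget.
  apply: runs_ret => /=; have Ac' := lt_trans Ac cc'.
  case: leP => [Dc' | Dc']; [exists c => //; right; exists c' | ].
    by split; rewrite ?(ltW Ac) ?(ltW Dc_gt0) ?(ltW cc') // cgt_le_cge_next.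
  have c'hi := hi_ok_gt hi_c Dc'.
  split=> //; first by split=> //=; rewrite lte_fin cc'.
    by rewrite /= gt_eqF.
  rewrite /next_lo /next_hi /= Dc' ltNge (ltW Dc') /=.
  apply: (potential_lt _ _ c'a) => //.
    by rewrite lee_fin ltW // (lt_trans lc).
  by rewrite ltxx c'hi lte_fin (lt_trans lc cc') orbT.
apply: (runs_bind_eq (left_dF_runs fuel hi)); first by budget.
rewrite slope_eq; apply: runs_bind_charge; first by budget.
case: eqP => [eqR | /eqP neqR].
- apply: runs_bind_charge; first by budget.
  case: ltP => [Dc_lt0 | Dc_ge0]; last first.
    apply: runs_bind_ret; apply: runs_bind_charge; first by budget.
    rewrite /= Dc_ge0; apply: runs_ret; exists c => //; right.
    have Dc_gt0 : 0 < D c by rewrite lt_neqAle eq_sym Dc.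
    case: hi hi_c lt_hi below eqR => [h [Ah Dh] ch _ | _ _ _ | //].
      rewrite num_geE_fin => eqR; rewrite lte_fin in ch; exists h.
      by split; rewrite ?(ltW Ac) ?(ltW ch) ?(ltW Dh) // -eqR cgt_le_cge.
    have [z za cz] := entry_above (ltW Ac) Dc_gt0.
    rewrite /num_geE (eq_count (a2 := pred0)) ?count_pred0 => [c0 | x].
      have : (0 < cge c)%N; last by rewrite c0.
      by rewrite -has_count; apply/hasP; exists z => //; apply: ltW.
    by apply/negbTE; rewrite -ltNge ltry.
  have lt_cA : (cge c < cge A)%N.
    by apply: leq_ltn_trans cge_next_entry; rewrite -lt_next_entry.
  have [z za /andP[Az zc]] := cge_lt_mem lt_cA.
  have has_c : has (fun x => x < c) a by apply/hasP; exists z.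
  pose Q (new : pivot_state R * R) := exists c', [/\ c' \in a, c' < c, A <= c',
    forall y, y \in a -> y < c -> y <= c'
    & new = (Pivot c' lo c%:E lb rb, D c')].
  apply: (@runs_bind _ _ _ _ _ _ (42 * (n * n)) Q).
  + apply: (runs_bind (max_of_runs fuel has_c)); first by budget.
    move=> c' [c'a cc' max_c'].
    apply: (runs_bind_eq (evalD_runs n_fuel c')); first by budget.
    by apply: runs_ret; exists c'; split=> //; apply: le_trans (max_c' _ za zc).
  + by budget.
  move=> _ [c' [c'a c'c Ac' max_c' ->]].
  apply: runs_bind_charge; first by budget.
  apply: runs_ret => /=.
  case: leP => [Dc' | Dc']; [exists c' => //; right; exists c | ].
    split; rewrite ?(ltW c'c) ?(ltW Dc_lt0) // cgt_le_cge_next // => y ya c'y.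
    by rewrite leNgt; apply/negP => /(max_c' _ ya); rewrite leNgt c'y.
  have Ac'_lt : A < c' by apply: D_le0_gt => //; apply: ltW.
  have lo_c' := lo_ok_lt lo_c Ac' Dc'.
  split=> //; last 1 first.
  + rewrite /next_lo /next_hi /= Dc' ltNge (ltW Dc') /=.
    apply: (potential_lt _ _ c'a) => //.
      by rewrite ltW // (lt_trans _ lt_hi) // lte_fin.
    by rewrite ltxx andbF (ltW lo_c') (lt_trans _ lt_hi) ?lte_fin.
  + split=> //=; first by rewrite lo_c' lte_fin.
    move=> /below[h eh ch]; exists c => //.
    rewrite eh lte_fin in lt_hi; exact: leq_trans ch (cge_le a (ltW lt_hi)).
  + by rewrite /= lt_eqF.
apply: runs_ret; split=> //; first by split=> //=; rewrite lo_lt.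
rewrite /next_lo /next_hi /=.
have [Dlt | Dgt | D0] /= := ltgtP (D c) 0; last by rewrite D0 eqxx in Dc.
- have lt_c : (num_geE a hi < num_geE a c%:E)%N.
    by rewrite ltn_neqAle num_geE_le ?(ltW lt_hi) // num_geE_fin eq_sym neqR.
  have [z za /andP[cz zhi]] := geE_lt_mem lt_c.
  apply: (potential_lt _ _ za); rewrite ?(ltW lt_hi) //.
  by rewrite (le_trans (ltW lo_lt) cz) zhi /= ltNge cz andbF.
- have lt_c : (num_geE a c%:E < num_geE a lo)%N.
    by rewrite ltn_neqAle num_geE_le ?(ltW lo_lt) // num_geE_fin neqL.
  have [z za /andP[loz zc]] := geE_lt_mem lt_c.
  apply: (potential_lt _ _ za); rewrite ?(ltW lo_lt) //.
  by rewrite loz (lt_trans zc lt_hi) /= leNgt zc.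
Qed.

Lemma pivot_body_runs fuel st : (2 * n + 2 < fuel)%N -> started st ->
  runs (pivot_body a k r eps initN st) fuel (240 * (n * n))
    (fun o => match o with
     | inr e => exists2 x, e = x%:E & exact_start x
     | inl st' => [/\ bracket st, bracket st'
         & (potential (uL st') (uR st') < potential (uL st) (uR st))%N]
     end).
Proof.
move=> n2_fuel st_ok; have n_fuel : (n < fuel)%N by clear -n2_fuel; lia.
case: st st_ok => c lo hi lb rb st_ok.
have P1_ok : runs (loop (P1_body a k hi) c) fuel (6 * n * (2 * n + 2).+1)
    (fun c' => trial (Pivot c' lo hi lb rb) /\ bracket (Pivot c lo hi lb rb)
               \/ D c' = 0).
  case: st_ok => [br | [/= Ac Dc]].
    apply: runs_weaken (P1_runs n2_fuel br) _ _ => // c' [Ac' cc' c'hi].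
    have [/= lo_c hi_c /andP[lo_lt _] below] := br.
    left; split=> //; split=> //=.
      by rewrite c'hi (lt_le_trans lo_lt) // lee_fin.
    by move=> /below[h [eh ch _]]; exists h.
  apply: runs_weaken (@runs_loop _ _ _ _ (6 * n) (fun _ x => x = c)
    (fun x => x = c) 0 c _ _ (erefl c)) _ _.
  - move=> t x _ ->.
    apply: (runs_bind_eq (left_dF_runs fuel c%:E)); first by budget.
    rewrite num_geE_fin; apply: runs_bind_charge; first by budget.
    rewrite slope_gt1 ltnNge -lt_next_entry Ac; exact: runs_ret.
  - by clear -n2_fuel; lia.
  - by clear; nia.
  - by move=> _ ->; right.
apply: (runs_bind P1_ok); first by budget.
move=> c' c'_ok.
apply: (runs_bind_eq (evalD_runs n_fuel c')); first by budget.
apply: runs_bind_charge; first by budget.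
case: leP => [small | large].
  by apply: runs_ret; exists c' => //; left.
case: c'_ok => [[tr br] | Dc'0]; last first.
  by rewrite Dc'0 normr0 ltNge eps_ge0 in large.
have Dc' : D c' != 0.
  by apply: contraTneq large => ->; rewrite normr0 -leNgt.
apply: (runs_bind (P3_runs n_fuel tr Dc')); first by budget.
case=> [[st2 d] [-> tr2 D2 pot] | e e_ok]; last exact: runs_ret.
apply: runs_weaken (P4_P5_runs n_fuel tr2 D2) _ _; first by budget.
by move=> _ [st4 [-> br4 -> ->]].
Qed.

Lemma pivot_loop_runs fuel st : (2 * n + 2 < fuel)%N -> started st ->
  runs (loop (pivot_body a k r eps initN) st) fuel
    (240 * (n * n) * (2 * n).+1)
    (fun e => exists2 x, e = x%:E & exact_start x).
Proof.
move=> n2_fuel st_ok.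
pose Inv j (x : pivot_state R) :=
  started x /\ (bracket x -> (potential (uL x) (uR x) <= j)%N).
apply: (@runs_loop _ _ _ _ _ Inv) => //.
- move=> j x _ [x_ok pot].
  apply: runs_weaken (pivot_body_runs n2_fuel x_ok) _ _ => // -[x' | //].
  case=> /pot le_pot br' lt_pot; exists (potential (uL x') (uR x')).
    exact: leq_trans le_pot.
  by split; first left.
- by clear -n2_fuel; lia.
- by split=> // _; apply: potential_le.
Qed.

(** * The pivot and exact steps together *)

Lemma final_runs fuel (u : \bar R) l :
  runs (final a u l) fuel (4 * n) (fun s : seq R => size s = n).
Proof.
apply: runs_weaken (runs_mapC_charge _ _ _ _) _ _ => // x <-.
by rewrite size_map.
Qed.

Lemma pivot_and_exact_runs fuel st : (2 * n + 2 < fuel)%N -> started st ->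
  runs (pivot_and_exact a k r eps initN st) fuel (1000 * (n * n * n))
    (fun s : seq R => size s = n).
Proof.
move=> n2_fuel st_ok; have n_fuel : (n < fuel)%N by clear -n2_fuel; lia.
apply: (runs_bind (pivot_loop_runs n2_fuel st_ok)).
  by budget.
move=> _ [u0 -> start]; apply: runs_bind_ret.
apply: (runs_bind (exact_runs n_fuel start)).
  by budget.
move=> u _; apply: (runs_bind_eq (count_ge_runs fuel u)).
  by budget.
apply: runs_bind_charge; first by budget.
apply: (@runs_bind _ _ _ _ _ _ (2 * n) (fun _ => True)).
- case: eqP => [ck | _]; last exact: runs_ret.
  have has_u : has (fun x => u <= x) a by rewrite has_count -/(cge u) ck.
  by apply: runs_weaken (min_of_runs fuel has_u) _ _.
- by budget.
move=> ustar _; apply: (runs_bind_eq (evalF_runs fuel ustar)).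
  by budget.
apply: runs_weaken (final_runs fuel _ _) _ _ => //.
by budget.
Qed.

End Pivot.

End Bracketing.

(** * The whole algorithm *)

Lemma EIPS_main_runs fuel : (2 * n + 2 < fuel)%N ->
  runs (EIPS_main a k r eps initN) fuel (1200 * (n * n * n))
    (fun s : seq R => size s = n).
Proof.
move=> n2_fuel; have n_fuel : (n < fuel)%N by clear -n2_fuel; lia.
apply: runs_bind_divide => //; first by budget.
apply: (runs_bind (init_runs n_fuel)); first by budget.
case=> [_ | u l _ | u [p|] left_u]; first exact: runs_ret.
- apply: runs_weaken (final_runs fuel _ _) _ _ => //.
  by budget.
- have infeas := infeasible left_u.
  have has_T : has predT a by rewrite has_predT.
  have [_ [top [_ _ [top_in _ top_max]]]] := max_of_runs fuel has_T.
  have {}top_max z : z \in a -> z <= top by move/top_max; apply.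
  apply: (runs_bind (start_flag23_runs infeas n_fuel left_u)).
    by budget.
  move=> st st_ok.
  have D_top := D_top_later top_max left_u.
  apply: runs_weaken
    (pivot_and_exact_runs infeas top_in top_max D_top n2_fuel st_ok) _ _ => //.
  by budget.
have infeas := infeasible left_u.
have has_T : has predT a by rewrite has_predT.
apply: (runs_bind (max_of_runs fuel has_T)).
  by budget.
move=> top [top_in _ top_max].
have {}top_max z : z \in a -> z <= top by move/top_max; apply.
apply: (runs_bind_eq (evalF_runs fuel top)).
  by budget.
apply: (runs_bind_eq (evalg_runs fuel top _)).
  by budget.
apply: runs_bind_charge; first by budget.
case: ltP => [_ | g_ge0].
  apply: runs_bind_divide => //; first by budget.
  apply: runs_weaken (final_runs fuel _ _) _ _ => //.
  by budget.
have D_top := D_top_first top_max left_u g_ge0.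
apply: (runs_bind (start_flag1_runs infeas top_in top_max n_fuel D_top)).
  by budget.
move=> st st_ok.
apply: runs_weaken
    (pivot_and_exact_runs infeas top_in top_max D_top n2_fuel st_ok) _ _ => //.
by budget.
Qed.

End Analysis.

Theorem theorem1 (R : realType) :
  exists C : nat,
    forall (n k : nat) (r : R) (a : n.-tuple R) (eps : R)
           (initN : nat -> seq R -> nat),
      (1 <= n)%N -> (1 <= k <= n)%N -> 0 <= eps ->
      (forall (H : nat) (b : seq R),
         (H < size b)%N -> (H < initN H b <= size b)%N) ->
      exists (fuel cost : nat) (x : n.-tuple R),
        EIPS a k r eps initN fuel = Some (cost, tval x) /\
        (cost <= C * ((n + k) * n ^ 2))%N.
Proof.
(* The general case costs at most [1200 n^3]; the tests on [k] come on top. *)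
exists 1300%N => n k r a eps initN n_gt0 /andP[k_gt0 k_n] eps_ge0 initN_ok.
(* The longest loop is the bisection, with at most [2 n + 3] passes. *)
pose fuel := (2 * n + 3)%N; exists fuel.
suff [cost [x [ex le_cost sz]]] :
    runs (EIPS a k r eps initN) fuel (1300 * (n * n * n)) (fun x => size x = n).
  exists cost, (tcast sz (in_tuple x)); rewrite val_tcast; split=> //.
  by apply: leq_trans le_cost _; nia.
have n_le : (n <= n * n * n)%N by nia.
have sz : size a = n by apply: size_tuple.
apply: runs_bind_charge; first by clear -n_le n_gt0; lia.
case: eqP => [_ | _].
  apply: runs_weaken (runs_mapC_charge _ _ _ _) _ _.
    by rewrite sz; clear -n_le n_gt0; lia.
  by move=> x <-; rewrite size_map.
apply: runs_bind_charge; first by clear -n_le n_gt0; lia.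
rewrite sz; case: eqP => [_ | /eqP k_neq].
  apply: (runs_bind_eq (sum_runs fuel (tval a))).
    by rewrite sz; clear -n_le n_gt0; lia.
  apply: runs_bind_charge; first by rewrite sz; clear -n_le n_gt0; lia.
  apply: runs_bind_divide; first by rewrite pnatr_eq0 -lt0n.
    by rewrite sz; clear -n_le n_gt0; lia.
  apply: runs_weaken (runs_mapC_charge _ _ _ _) _ _.
    by rewrite sz; clear -n_le n_gt0; lia.
  by move=> x <-; rewrite size_map.
have k_lt : (k < size a)%N by rewrite sz ltn_neqAle k_neq.
apply: runs_weaken
  (@EIPS_main_runs _ _ _ r _ _ k_gt0 k_lt eps_ge0 initN_ok fuel _) _ _.
- by rewrite sz /fuel; clear; lia.
- by rewrite sz; clear -n_le n_gt0; lia.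
- by move=> x ->.
Qed.
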